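(* Let $(M,\{D,J\})$ be a strictly pseudo-convex $CR$-manifold and let $G\leq\mathrm{Aut}_{CR}(M,\{D,J\})$ be a subgroup of $CR$-automorphisms that acts properly on $M$. Then there exists on $M$ a pseudo-Hermitian structure $\{\eta,J\}$ compatible with $\{D,J\}$ (that is, $\ker\eta=D$) such that $G\leq\mathrm{Psh}(M,\{\eta,J\})$.
   Context: A pseudo-Hermitian structure $\{\omega,J\}$ on a connected smooth manifold $M$ consists of a contact form $\omega$ and a complex structure $J$ on $\ker\omega$ such that the Levi form $d\omega(J\cdot,\cdot)$ is a positive definite Hermitian form on $\ker\omega$. A strictly pseudo-convex $CR$-structure is a pair $\{D,J\}$ with $D=\ker\omega$ induced by a pseudo-Hermitian structure $\{\omega,J\}$. $\mathrm{Psh}(M,\{\omega,J\})=\{\alpha\in\mathrm{Diff}(M)\mid\alpha^*\omega=\omega,\ \alpha_*\circ J=J\circ\alpha_*|_D\}$ and $\mathrm{Aut}_{CR}(M,\{D,J\})=\{\alpha\in\mathrm{Diff}(M)\mid\alpha_*D=D,\ \alpha_*\circ J=J\circ\alpha_*|_D\}$. The group $\mathrm{Aut}_{CR}(M,\{D,J\})$ is a Lie group acting smoothly on $M$, and $G$ is considered as a Lie subgroup. *)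

(* Defs.v *)
From HB Require Import structures.
From mathcomp Require Import all_boot all_order all_algebra perm.
From mathcomp Require Import all_classical all_reals all_analysis.

Set Implicit Arguments.
Unset Strict Implicit.
Unset Printing Implicit Defensive.

Import Order.TTheory GRing.Theory Num.Theory.
Import numFieldNormedType.Exports.

Local Open Scope classical_set_scope.
Local Open Scope ring_scope.

Section Calculus.
Context {R : realType} {V W : normedModType R}.

(* Meant for U open and V of finite dimension, where asking every directional
   derivative to be of class C^k amounts to the usual notion of class C^k.+1. *)
Fixpoint class_Ck (k : nat) (U : set V) (f : V -> W) : Prop :=
  match k with
  | 0 => forall x, U x -> {for x, continuous f}
  | k'.+1 => (forall x, U x -> differentiable f x) /\
             (forall v : V, class_Ck k' U (fun x => 'd f x v))
  end.

Definition smooth_on (U : set V) (f : V -> W) : Prop :=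
  forall k, class_Ck k U f.

End Calculus.

(* [cinv] is only meaningful on the image of the chart. *)
Record chart (R : realType) (m : nat) (T : topologicalType) := Chart {
  cdom : set T;
  cmap :> T -> 'rV[R]_m;
  cinv : 'rV[R]_m -> T;
  cdom_open : open cdom;
  cimg_open : open (cmap @` cdom);
  cmapK : forall p, cdom p -> cinv (cmap p) = p;
  cmap_continuous : forall p, cdom p -> {for p, continuous cmap};
  cinv_continuous : forall x, (cmap @` cdom) x -> {for x, continuous cinv} }.

Definition cimg (R : realType) (m : nat) (T : topologicalType)
  (c : chart R m T) : set 'rV[R]_m := c @` cdom c.

(* The preferred chart [chart_at p] around p only serves to represent tangent
   vectors: T_pM is the copy of R^m consisting of coordinate vectors with
   respect to [chart_at p]. *)
Record manifold (R : realType) (m : nat) (T : topologicalType) := Manifold {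
  mfd_hausdorff : hausdorff_space T;
  mfd_second_countable : @second_countable T;
  atlas : set (chart R m T);
  chart_at : T -> chart R m T;
  chart_at_atlas : forall p, atlas (chart_at p);
  chart_at_dom : forall p, cdom (chart_at p) p;
  chart_compat : forall c d, atlas c -> atlas d ->
    smooth_on [set x | cimg c x /\ cdom d (cinv c x)]
              (fun x => d (cinv c x)) }.

Section Maps.
Context {R : realType} {m1 m2 m3 : nat} {T1 T2 T3 : topologicalType}.
Variables (M1 : manifold R m1 T1) (M2 : manifold R m2 T2)
          (M3 : manifold R m3 T3).

Definition smooth_map (f : T1 -> T2) : Prop :=
  continuous f /\
  forall c d, atlas M1 c -> atlas M2 d ->
    smooth_on [set x | cimg c x /\ cdom d (f (cinv c x))]
              (fun x => d (f (cinv c x))).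

(* Smoothness of a map M1 x M2 -> M3, in the product charts of M1 x M2. *)
Definition smooth_map2 (f : T1 -> T2 -> T3) : Prop :=
  continuous (fun z : T1 * T2 => f z.1 z.2) /\
  forall c1 c2 d, atlas M1 c1 -> atlas M2 c2 -> atlas M3 d ->
    smooth_on [set z : 'rV[R]_m1 * 'rV[R]_m2 |
                 [/\ cimg c1 z.1, cimg c2 z.2
                   & cdom d (f (cinv c1 z.1) (cinv c2 z.2))]]
              (fun z => d (f (cinv c1 z.1) (cinv c2 z.2))).

Definition tangent_map (f : T1 -> T2) (p : T1) : 'rV[R]_m1 -> 'rV[R]_m2 :=
  'd (fun x => chart_at M2 (f p) (f (cinv (chart_at M1 p) x)))
     (chart_at M1 p p).

End Maps.

Section Tensors.
Context {R : realType} {m : nat} {T : topologicalType}.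
Variable M : manifold R m T.

Implicit Types (X : T -> 'rV[R]_m) (omega : T -> 'rV[R]_m -> R)
  (D : T -> set 'rV[R]_m) (J : T -> 'rV[R]_m -> 'rV[R]_m).

Definition vfield_in (c : chart R m T) X (x : 'rV[R]_m) : 'rV[R]_m :=
  let q := cinv c x in
  'd (fun y => c (cinv (chart_at M q) y)) (chart_at M q q) (X q).

Definition smooth_vfield (W : set T) X : Prop :=
  forall c, atlas M c ->
    smooth_on [set x | cimg c x /\ W (cinv c x)] (vfield_in c X).

Definition form_in (c : chart R m T) omega (x v : 'rV[R]_m) : R :=
  let q := cinv c x in
  omega q ('d (fun y => chart_at M q (cinv c y)) x v).

Definition smooth_form omega : Prop :=
  (forall p a u v, omega p (a *: u + v) = a * omega p u + omega p v) /\
  (forall c, atlas M c ->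
     forall v, smooth_on (cimg c) (fun x => form_in c omega x v)).

(* d omega (u, v) = u . omega(v) - v . omega(u) for the constant coordinate
   vector fields u, v of the preferred chart at p. *)
Definition dform omega (p : T) (u v : 'rV[R]_m) : R :=
  let c := chart_at M p in
  'd (fun x => form_in c omega x v : R) (c p) u -
  'd (fun x => form_in c omega x u : R) (c p) v.

Definition form_ker omega : T -> set 'rV[R]_m :=
  fun p => [set v | omega p v = 0].

(* J is only relevant on D: the values [J p v] with v outside D p are
   unconstrained.  The last clause is smoothness of the bundle map J. *)
Definition complex_structure_on D J : Prop :=
  [/\ forall p u, D p u -> D p (J p u),
      forall p a u v, D p u -> D p v ->
        J p (a *: u + v) = a *: J p u + J p v,
      forall p u, D p u -> J p (J p u) = - u
    & forall (W : set T) X, open W -> smooth_vfield W X ->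
        (forall p, W p -> D p (X p)) ->
        smooth_vfield W (fun p => J p (X p))].

Definition diffeo (f : T -> T) : Prop :=
  smooth_map M M f /\
  exists g, [/\ smooth_map M M g, cancel f g & cancel g f].

Definition preserves_J D J (f : T -> T) : Prop :=
  forall p u, D p u ->
    tangent_map M M f p (J p u) = J (f p) (tangent_map M M f p u).

Definition Psh omega J : set (T -> T) :=
  [set f | [/\ diffeo f,
               forall p v, omega (f p) (tangent_map M M f p v) = omega p v
             & preserves_J (form_ker omega) J f]].

Definition Aut_CR D J : set (T -> T) :=
  [set f | [/\ diffeo f,
               forall p, tangent_map M M f p @` D p = D (f p)
             & preserves_J D J f]].

End Tensors.

Section ContactGeometry.
Context {R : realType} {n : nat} {T : topologicalType}.
Variable M : manifold R n.*2.+1 T.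

Implicit Types (omega : T -> 'rV[R]_(n.*2.+1) -> R)
  (D : T -> set 'rV[R]_(n.*2.+1))
  (J : T -> 'rV[R]_(n.*2.+1) -> 'rV[R]_(n.*2.+1)).

(* The (2n+1)-form omega /\ (d omega)^n, up to a positive constant factor
   that depends only on n and on the normalisation of the wedge product. *)
Definition contact_volume omega (p : T)
    (e : 'I_n.*2.+1 -> 'rV[R]_(n.*2.+1)) : R :=
  \sum_(s : {perm 'I_n.*2.+1})
    (-1) ^+ s * (omega p (e (s ord0)) *
      \prod_(i < n) dform M omega p (e (s (inord i.*2.+1)))
                                    (e (s (inord i.*2.+2)))).

Definition contact_form omega : Prop :=
  smooth_form M omega /\
  forall p, exists e, contact_volume omega p e != 0.

Definition pseudo_hermitian omega J : Prop :=
  let D := form_ker omega in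
  let levi p u v := dform M omega p (J p u) v in
  [/\ contact_form omega,
      complex_structure_on M D J,
      forall p u v, D p u -> D p v -> levi p u v = levi p v u,
      forall p u v, D p u -> D p v -> levi p (J p u) (J p v) = levi p u v
    & forall p u, D p u -> u != 0 -> 0 < levi p u u].

Definition strictly_pseudoconvex_CR D J : Prop :=
  exists omega, pseudo_hermitian omega J /\ form_ker omega = D.

End ContactGeometry.

#[short(type="topologicalSpaceGroupType")]
HB.structure Definition TopologicalSpaceGroup :=
  {G of Topological G & Group G}.

Definition lie_group (R : realType) (k : nat) (G : topologicalSpaceGroupType)
    (S : manifold R k G) : Prop :=
  smooth_map2 S S S (fun g h : G => (g * h)%g) /\
  smooth_map S S (fun g : G => (g^-1)%g).

Definition smooth_action (R : realType) (k m : nat)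
    (G : topologicalSpaceGroupType) (S : manifold R k G)
    (T : topologicalType) (M : manifold R m T) (act : G -> T -> T) : Prop :=
  [/\ forall p, act 1%g p = p,
      forall g h p, act (g * h)%g p = act g (act h p)
    & smooth_map2 S M M act].

(* Properness of the map (g, p) |-> (g p, p) from G x T to T x T. *)
Definition proper_action (G T : topologicalType) (act : G -> T -> T) : Prop :=
  forall K : set (T * T), compact K ->
    compact [set z : G * T | K (act z.1 z.2, z.2)].

(* Main.v *)
Require Import Defs.
From HB Require Import structures.
From mathcomp Require Import all_boot all_order all_algebra perm.
From mathcomp Require Import all_classical all_reals all_analysis.
From mathcomp Require Import zify ring lra.

(** If g is a CR-automorphism then g^* omega = lambda_g omega, where
    lambda_g > 0 because g respects the Levi forms and n > 0.  Hence it is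
    enough to find a smooth h > 0 with h(g p) lambda_g(p) = h(p) for all g and
    p, and to take eta = h omega.  For a cutoff chi >= 0 of compact support,
    the average of lambda_g(p) chi(g p) over g, with respect to a
    right-invariant Haar integral, is such a function except that it may
    vanish: properness of the action makes the integrand compactly supported
    in g, locally uniformly in p.  A sum of such averages, locally finite
    because the cutoffs are chosen relatively to the saturations of an
    exhaustion of M by compact sets, is positive everywhere.
    The Haar integral is obtained, without measure theory, as the limit along
    an ultrafilter of Weil's covering numbers. *)

Set Implicit Arguments.
Unset Strict Implicit.
Unset Printing Implicit Defensive.

Import Order.TTheory GRing.Theory Num.Theory.
Import numFieldNormedType.Exports.

Local Open Scope classical_set_scope.
Local Open Scope ring_scope.

(** * Calculus *)

(** The multiplier is a cocycle: lambda_{gh}(p) = lambda_g(h p) lambda_h(p). Multiplying the average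
    at h p by lambda_h(p) therefore turns its integrand at g into the integrand at p taken at g h;
    this is why the integral must be right-invariant, and no modular function appears. For n = 0
    positivity of lambda fails: the reflection of the line preserves the zero distribution but no
    nowhere vanishing 1-form. Two obstacles shape the rest. Preferred charts vary with the point
    without any continuity, and so does the vector on which [multiplier] is evaluated; smoothness is
    therefore tested in fixed charts, where lambda is recovered as a quotient of smooth functions.
    And the integral is known only as a positive linear functional: differentiation under it rests
    on a bound |L f| <= C sup |f| for functions vanishing outside a fixed compact set, on the mean
    value theorem, and on joint continuity of the derivatives in the parameter. *)

Section Differential.
Context {R : realType}.
Implicit Types V W Z : normedModType R.

Lemma is_diff_approx V W (f : V -> W) (df : {linear V -> W}) (x : V) :
  continuous df ->
  (forall e : R, 0 < e ->
     \forall h \near 0, `|f (h + x) - f x - df h| <= e * `|h|) ->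
  is_diff x f df.
Proof.
move=> dfc H.
have E : f \o shift x = cst (f x) + df +o_ 0 id.
  apply/eqaddoP => e e0; near=> h.
  rewrite [X in `|X|](_ : _ = f (h + x) - f x - df h); first by near: h; exact: H.
  by rewrite /= opprD addrA.
have D := diff_unique dfc E.
by apply: DiffDef => //; apply/diff_locallyP; rewrite D.
Unshelve. all: by end_near. Qed.

Lemma diff_approx V W (f : V -> W) (x : V) (e : R) : differentiable f x ->
  0 < e ->
  \forall h \near 0, `|f (h + x) - f x - 'd f x h| <= e * `|h|.
Proof.
move=> /diff_locallyP[_ /eqaddoP /(_ e) H] /H; apply: filterS => h.
by rewrite /= opprD addrA.
Qed.

Lemma near_eq_is_diff V W (f g : V -> W) (x : V) :
  (\near x, f x = g x) -> differentiable f x -> is_diff x g ('d f x).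
Proof.
move=> fg df; apply: is_diff_approx; first exact: diff_continuous.
have N : \forall h \near (0 : V), f (h + x) = g (h + x).
  have : (fun h : V => h + x) @ 0 --> x.
    by rewrite -[X in _ --> X]add0r; apply: cvgD; [exact: cvg_id|exact: cvg_cst].
  by move=> /(_ _ fg).
move=> e e0; near=> h.
rewrite -(nbhs_singleton fg) -(_ : f (h + x) = g (h + x)); last by near: h.
by near: h; exact: diff_approx.
Unshelve. all: by end_near. Qed.

Lemma near_eq_diff V W (f g : V -> W) (x : V) :
  (\near x, f x = g x) -> differentiable f x -> 'd g x = 'd f x :> (V -> W).
Proof. by move=> fg df; have [] := near_eq_is_diff fg df. Qed.

Lemma near_eq_differentiable V W (f g : V -> W) (x : V) :
  (\near x, f x = g x) -> differentiable f x -> differentiable g x.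
Proof. by move=> fg df; have [] := near_eq_is_diff fg df. Qed.

Lemma near_eq_continuous (V W : topologicalType) (f g : V -> W) (x : V) :
  (\near x, f x = g x) -> {for x, continuous f} -> {for x, continuous g}.
Proof.
move=> fg cf; rewrite /prop_for /continuous_at -(nbhs_singleton fg).
by apply: cvg_trans cf; apply: near_eq_cvg.
Qed.

Lemma diffDE V W (f g : V -> W) (x v : V) :
  differentiable f x -> differentiable g x ->
  'd (fun y => f y + g y) x v = 'd f x v + 'd g x v.
Proof. by move=> df dg; have := congr1 (fun h => h v) (diffD df dg). Qed.

End Differential.

(** * Functions of class C^k and their composition *)

Section ClassCk.
Context {R : realType}.
Implicit Types V W Z : normedModType R.

Lemma eq_class_Ck V W k (U : set V) (f g : V -> W) : open U ->
  (forall x, U x -> f x = g x) -> class_Ck k U f -> class_Ck k U g.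
Proof.
move=> oU; elim: k f g => [|k IH] f g fg.
  move=> /= cf x Ux; apply: near_eq_continuous (cf x Ux).
  by apply: filterS fg _; exact: open_nbhs_nbhs.
have nfg x : U x -> \forall y \near x, f y = g y.
  by move=> Ux; apply: filterS fg _; exact: open_nbhs_nbhs.
move=> [df Cf]; split=> [x Ux|v].
  exact: near_eq_differentiable (nfg _ Ux) (df x Ux).
apply: IH (Cf v) => x Ux.
by rewrite (near_eq_diff (nfg _ Ux) (df x Ux)).
Qed.

(** [class_Ck] imposes conditions only at the points of [U], with derivatives taken in the whole
    space; hence [A] need be neither open nor a subset of [U]. *)
Lemma class_Ck_local V W k (U : set V) (f : V -> W) :
  (forall x, U x -> exists2 A : set V, A x & class_Ck k A f) ->
  class_Ck k U f.
Proof.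
elim: k f => [|k IH] f H.
  by move=> x /H[A Ax]; apply.
split=> [x /H[A Ax [+ _]]|v]; first exact.
by apply: IH => x /H[A Ax [_ /(_ v)]]; exists A.
Qed.

Lemma class_Ck_sub V W k (U A : set V) (f : V -> W) :
  A `<=` U -> class_Ck k U f -> class_Ck k A f.
Proof. by move=> AU Cf; apply: class_Ck_local => x Ax; exists U => //;
  exact: AU. Qed.

Lemma class_CkW V W k (U : set V) (f : V -> W) :
  class_Ck k.+1 U f -> class_Ck k U f.
Proof.
elim: k f => [|k IH] f [df Cf].
  by move=> x Ux; exact/differentiable_continuous/df.
by split=> // v; apply: IH.
Qed.

Lemma class_Ck_continuous V W k (U : set V) (f : V -> W) x :
  class_Ck k U f -> U x -> {for x, continuous f}.
Proof. by elim: k f => [|k IH] f; [apply|move/class_CkW/IH]. Qed.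

Lemma class_Ck_cst V W k (U : set V) (c : W) : class_Ck k U (fun=> c).
Proof.
elim: k c => [|k IH] c; first by move=> x _; exact: cst_continuous.
split=> [x _|v]; first exact: differentiable_cst.
rewrite [X in class_Ck _ _ X](_ : _ = fun=> 0) //.
by apply/funext => x; rewrite diff_cst.
Qed.

Lemma class_Ck_lin V W k (U : set V) (l : {linear V -> W}) :
  continuous l -> class_Ck k U l.
Proof.
move=> lc; case: k => [|k]; first by move=> x _; exact: lc.
split=> [x _|v]; first exact: linear_differentiable.
rewrite [X in class_Ck _ _ X](_ : _ = fun=> l v); first exact: class_Ck_cst.
by apply/funext => x; rewrite diff_lin.
Qed.

Lemma class_Ck_id V k (U : set V) : class_Ck k U (@id V).
Proof. by apply: (@class_Ck_lin _ _ k U idfun) => x. Qed.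

Lemma class_CkD V W k (U : set V) (f g : V -> W) : open U ->
  class_Ck k U f -> class_Ck k U g -> class_Ck k U (fun x => f x + g x).
Proof.
move=> oU; elim: k f g => [|k IH] f g.
  by move=> cf cg x Ux; apply: continuousD; [exact: cf|exact: cg].
move=> [df Cf] [dg Cg]; split=> [x Ux|v].
  by apply: differentiableD; [exact: df|exact: dg].
apply: eq_class_Ck (IH _ _ (Cf v) (Cg v)) => // x Ux.
exact/esym/(diffDE v (df _ Ux) (dg _ Ux)).
Qed.

Lemma class_Ck_sum V W k (U : set V) I (r : seq I) (F : I -> V -> W) : open U ->
  (forall i, class_Ck k U (F i)) -> class_Ck k U (fun x => \sum_(i <- r) F i x).
Proof.
move=> oU CF; elim: r => [|i r IH].
  by rewrite (_ : (fun _ => _) = fun=> 0);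
    [exact: class_Ck_cst|apply/funext => x; rewrite big_nil].
rewrite (_ : (fun _ => _) = fun x => F i x + \sum_(i <- r) F i x).
  exact: class_CkD.
by apply/funext => x; rewrite big_cons.
Qed.

Lemma is_diff_scale V W (a : V -> R) (f : V -> W) x :
  differentiable a x -> differentiable f x ->
  is_diff x (fun y => a y *: f y) (fun v => 'd a x v *: f x + a x *: 'd f x v).
Proof.
move=> da df.
have blin : bilinear_for *:%R *:%R (fun (a : R) (w : W) => a *: w).
  split=> [v|u] a1 u1 u2 /=; first by rewrite scalerDl scalerA.
  by rewrite scalerDr !scalerA mulrC.
pose B : {bilinear R -> W -> W} := HB.pack (fun (a : R) (w : W) => a *: w)
  (bilinear_isBilinear.Build _ _ _ _ _ _ _ blin).
have Bc : continuous (fun p : R * W => B p.1 p.2).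
  by move=> p; exact: scale_continuous.
have dp := differentiable_pair da df.
have dB : differentiable (fun p : R * W => B p.1 p.2) (a x, f x).
  exact: differentiable_bilin.
apply: DiffDef; first exact: (differentiable_comp dp dB).
rewrite [LHS](diff_comp dp dB) (diff_pair da df) diff_bilin //=.
by apply/funext => v /=; rewrite addrC.
Qed.

Lemma class_Ck_scale V W k (U : set V) (a : V -> R) (f : V -> W) : open U ->
  class_Ck k U a -> class_Ck k U f -> class_Ck k U (fun x => a x *: f x).
Proof.
move=> oU; elim: k a f => [|k IH] a f.
  by move=> ca cf x Ux; apply: cvgZ; [exact: ca|exact: cf].
move=> Ca Cf; case: (Ca) (Cf) => [da Ca'] [df Cf'].
have D x (Ux : U x) := is_diff_scale (da _ Ux) (df _ Ux).
split=> [x Ux|v]; first by have [] := D x Ux.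
apply: (@eq_class_Ck _ _ _ _
  (fun x => 'd a x v *: f x + a x *: 'd f x v)) => // [x Ux|].
  by have [_ E] := D x Ux; exact: (esym (congr1 (fun h => h v) E)).
apply: class_CkD => //.
  by apply: (IH (fun x => 'd a x v)); [exact: Ca'|exact: class_CkW].
by apply: IH; [exact: class_CkW|exact: Cf'].
Qed.

Lemma class_CkM V k (U : set V) (f g : V -> R) : open U ->
  class_Ck k U f -> class_Ck k U g -> class_Ck k U (fun x => f x * g x).
Proof. exact: class_Ck_scale. Qed.

Lemma class_CkV V k (U : set V) (f : V -> R) : open U ->
  (forall x, U x -> f x != 0) -> class_Ck k U f ->
  class_Ck k U (fun x => (f x)^-1).
Proof.
move=> oU f0; elim: k => [|k IH].
  by move=> cf x Ux; apply: cvgV; [exact: f0|exact: cf].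
move=> Cf; case: (Cf) => df Cf'; split=> [x Ux|v].
  by apply: differentiableV; [exact: df|exact: f0].
apply: (@eq_class_Ck _ _ _ _ (fun x =>
  (- 'd f x v) * ((f x)^-1 * (f x)^-1))) => //.
  move=> x Ux; rewrite diffV; [|exact: df|exact: f0].
  by rewrite expr2 invfM mulNr -[RHS]/(- _ * _) mulNr mulrC.
have Cf1 := IH (class_CkW Cf).
apply: (class_CkM (f := fun x => - 'd f x v)) => //; last exact: class_CkM.
apply: (@eq_class_Ck _ _ _ _ (fun x => (-1) * 'd f x v)) => //.
  by move=> x _; rewrite mulN1r.
apply: (class_CkM (f := fun=> -1)) => //; last exact: Cf'.
exact: class_Ck_cst.
Qed.

Lemma class_Ck_linl V W Z k (U : set V) (l : {linear W -> Z}) (f : V -> W) :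
  open U -> continuous l -> class_Ck k U f -> class_Ck k U (l \o f).
Proof.
move=> oU lc; elim: k f => [|k IH] f.
  by move=> cf x Ux; apply: continuous_comp; [exact: cf|exact: lc].
move=> [df Cf]; split=> [x Ux|v].
  by apply: differentiable_comp; [exact: df|exact: linear_differentiable].
apply: eq_class_Ck (IH _ (Cf v)) => // x Ux.
by rewrite diff_comp /= ?diff_lin //; [exact: df|exact: linear_differentiable].
Qed.

(* Finite dimension, with continuous coordinate forms. *)
Definition has_basis V := exists (n : nat) (b : 'I_n -> V)
  (l : 'I_n -> {linear V -> R}),
  (forall i, continuous (l i)) /\ forall v, v = \sum_i l i v *: b i.

(** The derivative of [g \o f] along [v] is ['d g (f x) ('d f x v)], whose direction moves with [x],
    whereas [class_Ck] speaks of fixed directions. Expanding ['d f x v] in a basis of [W] yields a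
    finite sum of products to which the induction hypothesis applies. *)
Lemma class_Ck_comp V W Z k (U : set V) (A : set W) (f : V -> W) (g : W -> Z) :
  has_basis W -> open U -> (forall x, U x -> A (f x)) ->
  class_Ck k U f -> class_Ck k A g -> class_Ck k U (g \o f).
Proof.
move=> [n [b [l [lc lb]]]] oU UA; elim: k g => [|k IH] g.
  move=> cf cg x Ux; apply: continuous_comp; first exact: cf.
  exact/cg/UA.
move=> Cf [dg Cg]; case: (Cf) => df Cf'; split=> [x Ux|v].
  by apply: differentiable_comp; [exact: df|exact/dg/UA].
apply: (@eq_class_Ck _ _ _ _
  (fun x => \sum_i (l i \o (fun y => 'd f y v)) x *: ('d g (f x) (b i)))) => //.
  move=> x Ux; rewrite (diff_comp (df _ Ux) (dg _ (UA _ Ux))) /=.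
  rewrite [X in 'd g (f x) X]lb linear_sum; apply: eq_bigr => i _.
  by rewrite linearZ.
apply: class_Ck_sum => // i; apply: class_Ck_scale => //.
  exact: class_Ck_linl (Cf' v).
by apply: (IH (fun y => 'd g y (b i))); [exact: class_CkW|exact: Cg].
Qed.

Lemma has_basis_real : has_basis R.
Proof.
exists 1%N, (fun=> 1), (fun=> idfun); split=> [_ x //|v].
by rewrite big_ord1 /= [LHS](esym (mulr1 _)).
Qed.

End ClassCk.

Section FiniteDimension.
Context {R : realType}.
Implicit Types V W : normedModType R.

Lemma linear_coord m (i : 'I_m) : linear (fun v : 'rV[R]_m => v 0 i : R).
Proof. by move=> a u v; rewrite !mxE. Qed.

Lemma has_basis_rV m : has_basis 'rV[R]_m.
Proof.
pose l i : {linear 'rV[R]_m -> R} := HB.pack (fun v : 'rV[R]_m => v 0 i : R)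
  (GRing.isLinear.Build _ _ _ _ _ (linear_coord i)).
exists m, (fun i => delta_mx 0 i), l; split=> [i|v];
  first exact: coord_continuous.
exact: row_sum_delta.
Qed.

Lemma is_diff_shift V W (f : V -> W) (x a : V) : differentiable f (x + a) ->
  is_diff x (fun y => f (y + a)) ('d f (x + a)).
Proof.
move=> df; apply: is_diff_approx; first exact: diff_continuous.
move=> e e0; apply: filterS (diff_approx df e0) => h.
by rewrite addrA.
Qed.

Lemma is_derive_line V (f : V -> R) (x h : V) (t : R) :
  differentiable f (x + t *: h) ->
  is_derive t 1 (fun s : R => f (x + s *: h)) ('d f (x + t *: h) h).
Proof.
move=> df.
have dl : is_diff t (fun s : R => x + s *: h) (fun s => 0 + s *: h).
  by apply: (is_diffD (f := cst x)).
have D : is_diff t (f \o fun s : R =>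
  x + s *: h) ('d f (x + t *: h) \o fun s => 0 + s *: h).
  by apply: is_diff_comp => //; exact: differentiableP.
case: D => D E; apply: DeriveDef; first exact: diff_derivable.
rewrite deriveE //.
by move: (congr1 (fun k => k 1) E); rewrite /= add0r scale1r.
Qed.

Lemma mvt_line V (f : V -> R) (x h : V) :
  (forall t : R, 0 <= t <= 1 -> differentiable f (x + t *: h)) ->
  exists2 t : R, 0 <= t <= 1 & f (x + h) - f x = 'd f (x + t *: h) h.
Proof.
move=> df.
have H : forall t : R, 0 <= t <= 1 ->
  is_derive t 1 (fun s : R => f (x + s *: h)) ('d f (x + t *: h) h).
  by move=> t t01; apply: is_derive_line; exact: df.
have [] := @MVT_segment R (fun s : R => f (x + s *: h))
  (fun t => 'd f (x + t *: h) h) 0 1 ler01.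
- by move=> t; rewrite in_itv /= => /andP[/ltW t0 /ltW t1]; apply: H; rewrite t0.
- apply: derivable_within_continuous => t; rewrite in_itv /= => t01.
  by have [] := H t t01.
move=> t; rewrite in_itv /= => t01 E; exists t => //.
by move: E; rewrite scale1r scale0r addr0 subr0 mulr1.
Qed.

(* Both mixed derivatives are limits of the second difference quotient. *)
Lemma class_C2_schwarz V (U : set V) (f : V -> R) (x u v : V) :
  open U -> U x -> class_Ck 2 U f ->
  'd (fun y => 'd f y u) x v = 'd (fun y => 'd f y v) x u.
Proof.
move=> oU Ux [df Cf].
have [r r0 Br] : exists2 r : R, 0 < r & forall y, `|y - x| < r -> U y.
  have /nbhs_ballP[r r0 Br] := open_nbhs_nbhs (conj oU Ux).
  by exists r => // y yr; apply: Br; rewrite -ball_normE /= distrC.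
have key w1 w2 (e : R) : 0 < e -> \forall h \near (0 : R)^'+,
   `|(f (x + h *: w1 + h *: w2) - f (x + h *: w1) - f (x + h *: w2) + f x)
     - h ^+ 2 * 'd (fun y => 'd f y w1) x w2| <= h ^+ 2 * e.
  move=> e0.
  have c2 : {for x, continuous (fun y => 'd (fun y => 'd f y w1) y w2)}.
    by have [_ C2] := Cf w1; exact: (C2 w2).
  have /cvgrPdist_lt /(_ e e0) /nbhs_normP[d d0 Bd] := c2.
  set N := `|w1| + `|w2| + 1.
  have N0 : 0 < N by rewrite ltr_wpDl ?addr_ge0.
  near=> h.
  have h0 : 0 < h by [].
  have hN : h * N < Num.min r d.
    rewrite -ltr_pdivlMr //; near: h; apply: nbhs_right_lt.
    by rewrite divr_gt0 // lt_min r0 d0.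
  have small (s t : R) : 0 <= s <= 1 -> 0 <= t <= 1 ->
     `|x + s *: (h *: w1) + t *: (h *: w2) - x| < Num.min r d.
    move=> /andP[s0 s1] /andP[t0 t1]; apply: le_lt_trans hN.
    rewrite addrAC (addrC x) addrK; apply: le_trans (ler_normD _ _) _.
    rewrite !normrZ (ger0_norm s0) (ger0_norm t0) (gtr0_norm h0) /N.
    rewrite 2!mulrDr -[X in X <= _]addr0 lerD ?mulr_ge0 ?(ltW h0) //.
    by rewrite lerD // ler_piMl // mulr_ge0 // ltW.
  have inU (s t : R) : 0 <= s <= 1 -> 0 <= t <= 1 ->
    U (x + s *: (h *: w1) + t *: (h *: w2)).
    by move=> s01 t01; apply: Br; have := small _ _ s01 t01;
      rewrite lt_min => /andP[].
  (* The second difference of [f] is a first difference of [g]. The mean value theorem for [g] along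
     [h *: w1], then for ['d f _ w1] along [h *: w2], gives h^2 times the mixed derivative at a
     point close to [x]. *)
  pose g (y : V) := f (y + h *: w2) - f y.
  have dfs (y : V) : U (y + h *: w2) -> U y ->
      is_diff y g (fun z => 'd f (y + h *: w2) z - 'd f y z).
    move=> Uy2 Uy; apply: (is_diffB (f := fun z => f (z + h *: w2))).
      by apply: is_diff_shift; exact: df.
    exact: differentiableP (df _ Uy).
  have i01 : 0 <= (1 : R) <= 1 by rewrite ler01 lexx.
  have i00 : 0 <= (0 : R) <= 1 by rewrite ler01 lexx.
  have dg (s : R) : 0 <= s <= 1 -> is_diff (x + s *: (h *: w1)) g
     (fun z => 'd f (x + s *: (h *: w1) + h *: w2) z - 'd f (x + s *: (h *:
       w1)) z).
    move=> s01; apply: dfs; first by have := inU s 1 s01 i01; rewrite scale1r.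
    by have := inU s 0 s01 i00; rewrite scale0r addr0.
  have [s s01 Es] : exists2 s : R, 0 <= s <= 1 &
      g (x + h *: w1) - g x = 'd g (x + s *: (h *: w1)) (h *: w1).
    by apply: mvt_line => t /dg[].
  have [t t01 Et] : exists2 t : R, 0 <= t <= 1 &
      'd f (x + s *: (h *: w1) + h *: w2) w1 - 'd f (x + s *: (h *: w1)) w1 =
      'd (fun y => 'd f y w1) (x + s *: (h *: w1) + t *: (h *: w2)) (h *: w2).
    apply: (mvt_line (f := fun y => 'd f y w1)) => t t01.
    by have [+ _] := Cf w1; apply; exact: inU.
  rewrite (_ : f _ - _ - _ + _ = g (x + h *: w1) - g x); last first.
    by rewrite /g opprB addrA addrAC.
  rewrite Es; have [_ ->] := dg _ s01.
  
  have LZ (k : {linear V -> R}) w : k (h *: w) = h * k w by rewrite linearZ.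
  rewrite !LZ -mulrBr Et LZ mulrA -expr2 -mulrBr normrM.
  rewrite ger0_norm ?sqr_ge0 // ler_wpM2l ?sqr_ge0 // distrC ltW //.
  by apply: Bd; rewrite /= distrC; have := small _ _ s01 t01;
    rewrite lt_min => /andP[].
apply/eqP; rewrite -subr_eq0 -normr_le0; apply/ler_addgt0Pr => e e0.
have e2 : 0 < e / 2 by rewrite divr_gt0.
rewrite add0r; near (0 : R)^'+ => h.
have h0 : 0 < h by [].
have h2 : 0 < h ^+ 2 by rewrite exprn_gt0.
have K1 : `|(f (x + h *: u + h *: v) - f (x + h *: u) - f (x + h *: v) + f x)
     - h ^+ 2 * 'd (fun y => 'd f y u) x v| <= h ^+ 2 * (e / 2).
  by near: h; exact: key.
have K2 : `|(f (x + h *: v + h *: u) - f (x + h *: v) - f (x + h *: u) + f x)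
     - h ^+ 2 * 'd (fun y => 'd f y v) x u| <= h ^+ 2 * (e / 2).
  by near: h; exact: key.
rewrite -(ler_pM2l h2) -[X in X * `|_|](gtr0_norm h2) -normrM mulrBr.
have := lerD K2 K1; rewrite -mulrDr -splitr; apply: le_trans.
apply: le_trans (ler_normB _ _); rewrite (addrAC x).
by rewrite le_eqVlt; apply/orP; left; apply/eqP; congr `|_|; ring.
Unshelve. all: by end_near. Qed.

End FiniteDimension.

(** The sets [A] with [P (K \ A)] form a filter, which is proper if [P K] fails. By compactness it
    then has a cluster point [x] in [K]; but a neighbourhood [B] of [x] with [P B] has its
    complement in the filter, a contradiction. *)
Lemma compact_ind (T : topologicalType) (P : set T -> Prop) (K : set T) :
  compact K -> P set0 -> (forall A B, A `<=` B -> P B -> P A) ->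
  (forall A B, P A -> P B -> P (A `|` B)) ->
  (forall x, K x -> exists2 B, nbhs x B & P B) -> P K.
Proof.
move=> cK P0 PS PU Pl; apply: contrapT => nPK.
pose F : set_system T := [set A | P (K `\` A)].
have FF : ProperFilter F.
  apply: Build_ProperFilter_ex => [A PA|].
    apply: contrapT => nA; apply: nPK; apply: PS PA => x Kx; split => // Ax.
    by apply: nA; exists x.
  split; first by rewrite /F /= setDT.
  - by move=> A B; rewrite /F /= setDIr; exact: PU.
  - move=> A B AB; rewrite /F /=; apply: PS => x [Kx nBx]; split => // Ax.
    exact/nBx/AB.
have [x [Kx cx]] : K `&` cluster F !=set0.
  by apply: cK; rewrite /F /= setDv.
have [B nB PB] := Pl x Kx.
have [] := cx (~` B) B _ nB.
  by rewrite /F /= setDE setCK; apply: PS PB => y [].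
by move=> y [].
Qed.

(** * Haar integral *)

Section CompactSupport.
Context {R : realType} {G : topologicalType}.
Implicit Types (f : G -> R).

Definition Cc f := continuous f /\ exists2 K, compact K & forall g, f g != 0 ->
  K g.
Definition Ccp f := Cc f /\ forall g, 0 <= f g.

Lemma CcD f1 f2 : Cc f1 -> Cc f2 -> Cc (fun g => f1 g + f2 g).
Proof.
move=> [c1 [K1 k1 s1]] [c2 [K2 k2 s2]]; split.
  by move=> g; apply: continuousD; [exact: c1|exact: c2].
exists (K1 `|` K2); first exact: compactU.
move=> g; have [E|/s1 ? _] := eqVneq (f1 g) 0; last by left.
by rewrite E add0r => /s2; right.
Qed.

Lemma CcZ a f : Cc f -> Cc (fun g => a * f g).
Proof.
move=> [c [K k s]]; split; first by move=> g; apply: cvgM;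
  [exact: cvg_cst|exact: c].
by exists K => // g; rewrite mulf_eq0 negb_or => /andP[_ /s].
Qed.

Lemma Cc_pos f : Cc f -> Ccp (fun g => Num.max (f g) 0).
Proof.
move=> [c [K k s]]; split; last by move=> g; rewrite le_max lexx orbT.
split; first by move=> g; apply: (continuous_max (c g)); exact: cvg_cst.
by exists K => // g f0; apply: s; apply: contra_neq f0 => ->; rewrite maxxx.
Qed.

Lemma Cc_bounded f : Cc f -> exists2 B, 0 < B & forall g, f g <= B.
Proof.
move=> [c [K k s]].
have [B [B0 KB]] : exists B, 0 < B /\ forall g, K g -> f g <= B.
  apply: (compact_ind (P := fun A =>
    exists B, 0 < B /\ forall g, A g -> f g <= B) k).
  - by exists 1; split.
  - by move=> A A' AA' [B [B0 H]]; exists B; split=> // g /AA'/H.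
  - move=> A1 A2 [B1 [b1 H1]] [B2 [b2 H2]]; exists (B1 + B2); rewrite addr_gt0 //.
    split=> // g [/H1|/H2] H; first by rewrite (le_trans H) // lerDl ltW.
    by rewrite (le_trans H) // lerDr ltW.
  move=> g _; exists (f @^-1` [set y | y < `|f g| + 1]).
    apply: (c g); apply: lt_nbhsl; first by rewrite ltr_pwDr // ler_norm.
  exists (`|f g| + 1); split; first by rewrite ltr_wpDl.
  by move=> h /ltW.
exists B => // g; have [->|/s] := eqVneq (f g) 0; [exact: ltW|exact: KB].
Qed.

Lemma pos_continuous_on_compact f K : continuous f -> compact K ->
  (forall g, K g -> 0 < f g) -> exists d, 0 < d /\ forall g, K g -> d <= f g.
Proof.
move=> c k fK.
have key : forall A, A `<=` K -> compact A ->
    exists d, 0 < d /\ forall g, A g -> d <= f g.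
  move=> A AK kA.
  apply: (compact_ind (P := fun A =>
    exists d, 0 < d /\ forall g, A g -> d <= f g) kA).
  - by exists 1; split.
  - by move=> B C BC [d [d0 H]]; exists d; split=> // g /BC/H.
  - move=> B C [d [d0 H]] [e [e0 H']]; exists (Num.min d e).
    by rewrite lt_min d0 e0; split=> // g [/H|/H'] le; rewrite ge_min le ?orbT.
  move=> g /AK/fK fg; exists [set y | f g / 2 < f y].
    apply: (c g [set y | f g / 2 < y]); apply: lt_nbhsr.
    by rewrite ltr_pdivrMr // ltr_pMr // ltr1n.
  by exists (f g / 2); split=> [|y /ltW //]; rewrite divr_gt0.
exact: key.
Qed.

End CompactSupport.

Section HaarFunctional.
Context {R : realType} {G : topologicalSpaceGroupType}.
Context (mulc : continuous (fun z : G * G => (z.1 * z.2)%g))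
  (G_hausdorff : hausdorff_space G).
Implicit Types (f phi psi : G -> R) (s : seq (R * G)).
Local Notation "f .* t" := (fun g => f (g * t)%g) (at level 20).

Lemma mulgr_continuous (t : G) : continuous (fun g : G => (g * t)%g).
Proof.
move=> g; apply: (@continuous_comp _ _ _ (fun g => (g, t)) (fun z : G * G =>
  (z.1 * z.2)%g)).
  by apply: cvg_pair => //=; exact: cvg_cst.
exact: mulc.
Qed.

Lemma Cc_translate t f : Cc f -> Cc (f .* t).
Proof.
move=> [c [K k s]]; split.
  by move=> g; apply: (@continuous_comp _ _ _ (fun g => g * t)%g f);
    [exact: mulgr_continuous|exact: c].
exists ((fun g => g * t^-1)%g @` K).
  by apply: continuous_compact k; apply: continuous_subspaceT;
    exact: mulgr_continuous.
by move=> g /s Kg; exists (g * t)%g => //; rewrite mulgK.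
Qed.

Lemma Cc_unif (f : G -> R) (e : R) (invc : continuous (fun g : G => g^-1%g)) :
  Cc f -> 0 < e ->
  \forall v \near 1%g, forall t, `|f (v * t)%g - f t| <= e.
Proof.
move=> [c [K k s]] e0.
(* The clause with [v^-1] serves the points [t] outside [K] for which [v * t] lies in [K]: it is
   applied at [v * t], which [v^-1] sends back to [t]. *)
pose P (v t : G) := `|f (v * t)%g - f t| <= e /\ `|f (v^-1 * t)%g - f t| <= e.
have cP (h : G -> G) (t : G) : h 1%g = 1%g -> continuous h ->
    \forall t' \near t & v \near 1%g, `|f (h v * t')%g - f t'| <= e.
  move=> h1 hc.
  have C : (fun z : G * G => f (h z.2 * z.1)%g - f z.1) @ (t, 1%g) --> (0 : R).
    rewrite -(subrr (f t)); apply: cvgB; last first.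
      by apply: (@cvg_comp _ _ _ fst f _ (nbhs t)); [exact: cvg_fst|exact: c].
    have C2 : (fun z : G * G => h z.2 * z.1)%g @ (t, 1%g) --> (h 1%g * t)%g.
      apply: (@continuous_comp _ _ _ (fun z : G * G => (h z.2, z.1))
        (fun z : G * G => (z.1 * z.2)%g) (t, 1%g)); last exact: mulc.
      apply: (@cvg_pair _ _ _ _ (nbhs (h 1%g)) (nbhs t)); last exact: cvg_fst.
      by apply: (@cvg_comp _ _ _ snd h _ (nbhs 1%g)); [exact: cvg_snd|exact: hc].
    rewrite h1 mul1g in C2.
    by apply: (@cvg_comp _ _ _ (fun z : G * G => h z.2 * z.1)%g f _ (nbhs t));
      last exact: c.
  have /cvgrPdist_le/(_ e e0)/= := C.
  move=> [[A B] /= [nA nB] AB]; exists (A, B) => // -[t' v] [/= At Bv].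
  by have := AB (t', v) (conj At Bv); rewrite /= sub0r normrN.
have /compact_near_coveringP /(_ G (nbhs 1%g) P) := k.
move=> /(_ _) H.
have {}H : \forall v \near 1%g, K `<=` P v.
  apply: H => t Kt; apply: filterS2 (cP id t _ _) (cP _ t (invg1 _) invc) => //.
  by move=> x.
apply: filterS H => v Kv t.
have [Kt|nKt] := pselect (K t); first by have [] := Kv t Kt.
have [Kvt|nKvt] := pselect (K (v * t)%g).
  by have [_] := Kv _ Kvt; rewrite mulKg distrC.
have f0 g : ~ K g -> f g = 0 by move=> nK; apply/eqP; apply: contra_notT nK => /s.
by rewrite !f0 // subr0 normr0 ltW.
Qed.

(** A pair [(a, t)] of [s] stands for [a] times the right translate of [phi] by [t]; using right
    translates makes the covering number, and later [L], right-invariant. *)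
Definition dominates f phi s := all (fun c => 0 <= c.1) s /\
  forall g, f g <= \sum_(c <- s) c.1 * phi (g * c.2)%g.

Definition weight s := \sum_(c <- s) c.1.

(* The covering number (f : phi) of Weil's construction of Haar measure. *)
Definition covering f phi : R := inf [set weight s | s in dominates f phi].

Definition nonneg_nonzero phi := Ccp phi /\ exists g, 0 < phi g.

Lemma weight_ge0 s : all (fun c => 0 <= c.1) s -> 0 <= weight s.
Proof. by move=> /allP s0; rewrite /weight big_seq sumr_ge0 // => c /s0. Qed.

Lemma dominates_exists f phi : Cc f -> nonneg_nonzero phi ->
  exists s, dominates f phi s.
Proof.
move=> [c [K k sK]] [[[phic _] phi0] [g1 phig1]].
pose P (A : set G) := exists s, all (fun c => 0 <= c.1) s /\
  forall g, A g -> f g <= \sum_(c <- s) c.1 * phi (g * c.2)%g.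
have sum0 s g : all (fun c =>
  0 <= c.1) s -> 0 <= \sum_(c <- s) c.1 * phi (g * c.2)%g.
  by move=> /allP s0; rewrite big_seq sumr_ge0 // => a /s0 ?; rewrite mulr_ge0.
have [s [s0 Ks]] : P K.
  apply: compact_ind k _ _ _ _.
  - by exists [::]; split.
  - by move=> A B AB [s [s0 H]]; exists s; split => // g /AB/H.
  - move=> A B [s [s0 H]] [s' [s'0 H']]; exists (s ++ s'); rewrite all_cat s0 s'0.
    split=> // g; rewrite big_cat /= => -[/H|/H'] le.
      by rewrite (le_trans le) // lerDl sum0.
    by rewrite (le_trans le) // lerDr sum0.
  (* Translation by [t] carries [g0] to the point [g1] where [phi] is positive. Near [g0] the
     translate exceeds [phi g1 / 2] and [f] stays below [|f g0| + 1], so the quotient of these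
     bounds is a sufficient coefficient. *)
  move=> g0 _; pose t := (g0^-1 * g1)%g.
  pose B := [set g | f g < `|f g0| + 1] `&` [set g | phi g1 / 2 < phi (g * t)%g].
  exists B.
    apply: filterI.
      apply: (c g0 [set y | y < `|f g0| + 1]); apply: lt_nbhsl.
      by rewrite ltr_pwDr // ler_norm.
    have C : {for g0, continuous (phi .* t)}.
      apply: (@continuous_comp _ _ _ (fun g => g * t)%g phi).
        exact: mulgr_continuous.
      exact: phic.
    apply: (C [set y | phi g1 / 2 < y]); apply: lt_nbhsr; rewrite /t mulVKg.
    by rewrite ltr_pdivrMr // ltr_pMr // ltr1n.
  exists [:: ((`|f g0| + 1) / (phi g1 / 2), t)]; split.
    by rewrite /= andbT divr_ge0 ?addr_ge0 // divr_ge0.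
  move=> g [fg pg]; rewrite big_seq1 /=; apply: le_trans (ltW fg) _.
  have p2 : 0 < phi g1 / 2 by rewrite divr_gt0.
  rewrite -mulrA ler_peMr ?addr_ge0 //.
  by rewrite ler_pdivlMl // mulr1 ltW.
exists s; split=> // g.
have [->|/sK] := eqVneq (f g) 0; [exact: sum0|exact: Ks].
Qed.

Lemma covering_has_inf f phi : Cc f -> nonneg_nonzero phi ->
  has_inf [set weight s | s in dominates f phi].
Proof.
move=> cf pp; split.
  by have [s H] := dominates_exists cf pp; exists (weight s), s.
by exists 0 => _ [s [s0 _] <-]; exact: weight_ge0.
Qed.

Lemma covering_le f phi s : dominates f phi s -> covering f phi <= weight s.
Proof.
move=> ds; apply: ge_inf; last by exists s.
by exists 0 => _ [s' [s0 _] <-]; exact: weight_ge0.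
Qed.

Lemma covering_ge f phi (x : R) : Cc f -> nonneg_nonzero phi ->
  (forall s, dominates f phi s -> x <= weight s) -> x <= covering f phi.
Proof.
move=> cf pp H; apply: lb_le_inf; first by have [] := covering_has_inf cf pp.
by move=> _ [s /H ? <-].
Qed.

Lemma covering_ge0 f phi : Cc f -> nonneg_nonzero phi -> 0 <= covering f phi.
Proof. by move=> cf pp; apply: covering_ge => // s [/weight_ge0]. Qed.

(** If [phi] is bounded by [B], evaluating a domination at [g] gives [f g <= B * weight s]; so every
    weight is at least [f g / B]. *)
Lemma covering_gt0 f phi g : Cc f -> nonneg_nonzero phi -> 0 < f g ->
  0 < covering f phi.
Proof.
move=> cf pp fg; have [[cphi _] _] := pp; have [B B0 HB] := Cc_bounded cphi.
apply: (@lt_le_trans _ _ (f g / B)); first by rewrite divr_gt0.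
apply: covering_ge => // s [/allP s0 ds].
rewrite ler_pdivrMr //; apply: le_trans (ds g) _.
rewrite /weight mulr_suml !big_seq; apply: ler_sum => c /s0 c0.
by rewrite ler_wpM2l.
Qed.

Lemma covering_mono f f' phi : Cc f -> Cc f' -> nonneg_nonzero phi ->
  (forall g, f g <= f' g) -> covering f phi <= covering f' phi.
Proof.
move=> cf cf' pp ff'; apply: covering_ge => // s [s0 ds].
by apply: covering_le; split=> // g; apply: le_trans (ff' g) (ds g).
Qed.

Lemma coveringD f f' phi : Cc f -> Cc f' -> nonneg_nonzero phi ->
  covering (fun g => f g + f' g) phi <= covering f phi + covering f' phi.
Proof.
move=> cf cf' pp; rewrite -lerBlDr; apply: covering_ge => // s [s0 ds].
rewrite lerBlDr -lerBlDl; apply: covering_ge => // s' [s'0 ds'].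
rewrite lerBlDl /weight -big_cat; apply: covering_le.
by split=> [|g]; rewrite ?all_cat ?s0 // big_cat /= lerD.
Qed.

Lemma covering_scale a s : weight [seq (a * c.1, c.2) | c <- s] = a * weight s.
Proof. by rewrite /weight big_map mulr_sumr. Qed.

Lemma dominates_scale a f phi s : 0 <= a -> dominates f phi s ->
  dominates (fun g => a * f g) phi [seq (a * c.1, c.2) | c <- s].
Proof.
move=> a0 [/allP s0 ds]; split=> [|g].
  by apply/allP => _ /mapP[c /s0 c0 ->]; rewrite /= mulr_ge0.
rewrite big_map /=; apply: le_trans (ler_wpM2l a0 (ds g)) _.
by rewrite mulr_sumr ler_sum // => c _; rewrite mulrA.
Qed.

Lemma coveringZ_le a f phi : 0 < a -> Cc f -> nonneg_nonzero phi ->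
  covering (fun g => a * f g) phi <= a * covering f phi.
Proof.
move=> a0 cf pp; rewrite -ler_pdivrMl //; apply: covering_ge => // s ds.
rewrite ler_pdivrMl // -covering_scale; apply: covering_le.
by apply: dominates_scale => //; exact: ltW.
Qed.

Lemma coveringZ a f phi : 0 <= a -> Cc f -> nonneg_nonzero phi ->
  covering (fun g => a * f g) phi = a * covering f phi.
Proof.
rewrite le_eqVlt => /orP[/eqP <-|a0] cf pp.
  apply/eqP; rewrite mul0r eq_le covering_ge0 ?andbT; [|exact: CcZ|by []].
  rewrite [leRHS](_ : 0 = weight [::]); last by rewrite /weight big_nil.
  by apply: covering_le; split=> // g; rewrite mul0r big_nil.
apply/eqP; rewrite eq_le coveringZ_le //= -ler_pdivlMl //.
apply: le_trans (coveringZ_le _ _ pp); rewrite ?invr_gt0 //; last exact: CcZ.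
by apply: covering_mono => //; [do 2 apply: CcZ|move=> g; rewrite mulKf ?gt_eqF].
Qed.

Lemma covering_translate_le t f phi : Cc f -> nonneg_nonzero phi ->
  covering (f .* t) phi <= covering f phi.
Proof.
move=> cf pp; apply: covering_ge => // s [s0 ds].
have -> : weight s = weight [seq (c.1, (t * c.2)%g) | c <- s].
  by rewrite /weight big_map.
apply: covering_le; split; first by rewrite all_map.
move=> g; rewrite big_map /=; apply: le_trans (ds _) _.
by apply: ler_sum => c _; rewrite mulgA.
Qed.

Lemma covering_translate t f phi : Cc f -> nonneg_nonzero phi ->
  covering (f .* t) phi = covering f phi.
Proof.
move=> cf pp; apply/eqP; rewrite eq_le covering_translate_le //=.
apply: le_trans (covering_translate_le t^-1%g _ pp); last exact: Cc_translate.
apply: covering_mono => //;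
  first exact: (Cc_translate t^-1%g (Cc_translate t cf)).
by move=> g; rewrite -mulgA mulVg mulg1.
Qed.

(** Inserting a domination of [psi] by [phi] into one of [f] by [psi] dominates [f] by [phi], and
    the weights multiply. This bounds the normalised covering numbers from above and, with the roles
    exchanged, away from zero. *)
Lemma covering_trans f psi phi : Cc f -> nonneg_nonzero psi ->
  nonneg_nonzero phi ->
  covering f phi <= covering f psi * covering psi phi.
Proof.
move=> cf psip pp; have [[cpsi psi0] [g1 psig1]] := psip.
have c0 : 0 < covering psi phi by exact: covering_gt0 psig1.
rewrite -ler_pdivrMr //; apply: covering_ge => // s [/allP s0 ds].
rewrite ler_pdivrMr //.
(* Division by a zero weight is impossible, but then all coefficients vanish, [f] is nonpositive,
   and the empty family dominates it. *)
have [w0|w0] := eqVneq (weight s) 0.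
  have sz c : c \in s -> c.1 = 0.
    move=> cs; apply/eqP; rewrite eq_le s0 // andbT -w0 /weight (big_rem c) //=.
    by rewrite lerDl big_seq sumr_ge0 // => c' /mem_rem /s0.
  rewrite w0 mul0r (_ : 0 = weight [::]); last by rewrite /weight big_nil.
  apply: covering_le; split => // g; rewrite big_nil (le_trans (ds g)) //.
  by rewrite big_seq big1 // => c /sz ->; rewrite mul0r.
have wp : 0 < weight s by rewrite lt_def w0 weight_ge0 //; apply/allP.
rewrite -ler_pdivrMl //; apply: covering_ge => // s' [/allP s'0 ds'].
rewrite ler_pdivrMl // /weight mulr_suml.
under eq_bigr do rewrite mulr_sumr.
pose s2 := flatten [seq [seq (c.1 * c'.1, (c.2 * c'.2)%g) | c' <- s'] | c <- s].
have -> : \sum_(c <- s) \sum_(c' <- s') c.1 * c'.1 = weight s2.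
  rewrite /weight /s2 big_flatten big_map; apply: eq_bigr => c _.
  by rewrite big_map.
apply: covering_le; split.
  apply/allP => x /flattenP[_ /mapP[c cs ->] /mapP[c' cs' ->]] /=.
  exact: mulr_ge0 (s0 _ cs) (s'0 _ cs').
move=> g; apply: le_trans (ds g) _.
rewrite /s2 big_flatten big_map !big_seq; apply: ler_sum => c cs.
rewrite big_map /=.
have := ler_wpM2l (s0 c cs) (ds' (g * c.2)%g).
rewrite mulr_sumr => /le_trans; apply; rewrite le_eqVlt; apply/orP; left.
by apply/eqP/eq_bigr => c' _; rewrite mulrA mulgA.
Qed.

Context (invc : continuous (fun g : G => g^-1%g))
  (bump : forall U, nbhs (1%g : G) U ->
     exists phi, [/\ Ccp phi, 0 < phi 1%g & forall g, phi g != 0 -> U g]).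

(** Sums of translates of one bump suffice. Such a function is added, with a small factor, to make a
    denominator positive on a compact set, and serves as a majorant for functions vanishing off
    [K]. *)
Lemma Ccp_pos_on_compact K : compact K ->
  exists2 psi : G -> R, Ccp psi & forall g, K g -> 0 < psi g.
Proof.
move=> k; apply: (compact_ind (P := fun K =>
  exists2 psi : G -> R, Ccp psi & forall g, K g -> 0 < psi g) k).
- by have [phi [cp _ _]] := bump filterT; exists phi.
- by move=> A B AB [psi cp H]; exists psi => // g /AB/H.
- move=> A B [p [cp p0] HA] [q [cq q0] HB]; exists (fun g => p g + q g).
    by split=> [|g]; [exact: CcD|exact: addr_ge0].
  by move=> g [/HA|/HB] H; [exact: ltr_pwDl|exact: ltr_wpDl].
move=> g0 _; have [phi [[cp p0] p1 _]] := bump filterT.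
exists [set g | 0 < phi (g * g0^-1)%g].
  have [c _] := Cc_translate g0^-1%g cp.
  by apply: (c g0 [set y | 0 < y]); apply: lt_nbhsr; rewrite mulgV.
exists (phi .* g0^-1%g) => //; split => [|g]; [exact: Cc_translate|exact: p0].
Qed.

(** Since [h] may vanish, continuity of the inverse is available on [K] only; off [K], which is
    closed, the quotient is zero in a neighbourhood because [f] is. *)
Lemma Cc_quotient f h : Cc f -> Cc h -> (forall g, 0 <= h g) ->
  (exists2 K, closed K /\ compact K & (forall g, f g != 0 ->
    K g) /\ forall g, K g -> 0 < h g) ->
  Cc (fun g => f g / h g).
Proof.
move=> [cf _] [ch _] h0 [K [Kc Kk] [fK Kh]]; split; last first.
  by exists K => // g; rewrite mulf_eq0 negb_or => /andP[/fK].
move=> g; have [Kg|nKg] := pselect (K g).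
  by apply: cvgM; [exact: cf|apply: cvgV; [rewrite gt_eqF ?Kh|exact: ch]].
have z g' : ~ K g' -> f g' / h g' = 0.
  by move=> n; rewrite (_ : f g' = 0) ?mul0r //; apply/eqP;
    apply: contra_notT n => /fK.
rewrite /continuous_at z //; apply: cvg_near_cst.
have : nbhs g (~` K) by apply: open_nbhs_nbhs; split=> //; exact: closed_openC.
by apply: filterS => g' /z.
Qed.

(* Weil's key step: the quotients f_i / (f1 + f2 + d psi) are uniformly
   continuous, hence almost constant on the translates of a small support. *)
Lemma covering_almost_additive f1 f2 f0 (e : R) : Ccp f1 -> Ccp f2 ->
  nonneg_nonzero f0 -> 0 < e ->
  exists2 U, nbhs (1%g : G) U & forall phi, nonneg_nonzero phi ->
    (forall g, phi g != 0 -> U g) ->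
    covering f1 phi + covering f2 phi <=
    covering (fun g => f1 g + f2 g) phi + e * covering f0 phi.
Proof.
move=> [c1 p1] [c2 p2] n0 e0.
have cf := CcD c1 c2; have [[_ [K k sK]] cf0] := (cf, n0).
have [psi [cpsi psi0] psiK] := Ccp_pos_on_compact k.
set A := covering (fun g => f1 g + f2 g) f0; set B := covering psi f0.
have A0 : 0 <= A by exact: covering_ge0.
have B0 : 0 <= B by exact: covering_ge0.
(* Let x, y, z be the covering numbers by [phi] of f1 + f2, psi and f0, so that x <= A z and y <= B
   z. The final estimate is (1 + 2d)(x + d y) <= x + d (2A + 3B) z, where 1 + 2d <= 3 uses d <= 1;
   the summand 1 keeps the denominator positive. *)
pose d := Num.min 1 (e / (2 * A + 3 * B + 1)).
have D0 : 0 < 2 * A + 3 * B + 1 by rewrite ltr_wpDl // addr_ge0 // mulr_ge0.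
have d0 : 0 < d by rewrite lt_min ltr01 divr_gt0.
have d1 : d <= 1 by rewrite ge_min lexx.
have de : d * (2 * A + 3 * B + 1) <= e.
  by rewrite -ler_pdivlMr // ge_min lexx orbT.
pose h g := (f1 g + f2 g) + d * psi g.
have ch : Cc h by apply: CcD => //; exact: CcZ.
have h0 g : 0 <= h g by rewrite !addr_ge0 // mulr_ge0 // ltW.
have hK g : K g -> 0 < h g.
  by move=> Kg; rewrite ltr_wpDl ?addr_ge0 // mulr_gt0 // psiK.
have Kcl : closed K by exact: compact_closed.
have f1K g : f1 g != 0 -> K g.
  by move=> n; apply: sK; rewrite gt_eqF // ltr_pwDl // lt_def n p1.
have f2K g : f2 g != 0 -> K g.
  by move=> n; apply: sK; rewrite gt_eqF // ltr_wpDl // lt_def n p2.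
have cq1 : Cc (fun g => f1 g / h g) by apply: Cc_quotient => //; exists K.
have cq2 : Cc (fun g => f2 g / h g) by apply: Cc_quotient => //; exists K.
exists [set v | (forall t, `|f1 (v * t)%g / h (v * t)%g - f1 t / h t| <= d) /\
                (forall t, `|f2 (v * t)%g / h (v * t)%g - f2 t / h t| <= d)].
  by apply: filterI; [exact: (Cc_unif invc cq1 d0)|exact: (Cc_unif invc cq2 d0)].
move=> phi np sphi; have [[_ phi0] _] := np.
(* If [phi (g * c.2)] is nonzero, then [g = v * c.2^-1] with [v] in the small neighbourhood, so f/h
   at [g] exceeds its value at [c.2^-1] by at most [d]. Writing f = (f/h) h thus turns a domination
   of [h] into one of [f], with each coefficient multiplied by that value plus [d]. *)
have dom f : Ccp f -> (forall g, f g != 0 -> K g) ->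
  (forall v, (forall t, `|f1 (v * t)%g / h (v * t)%g - f1 t / h t| <= d) /\
                (forall t, `|f2 (v * t)%g / h (v * t)%g - f2 t / h t| <= d) ->
    forall t, `|f (v * t)%g / h (v * t)%g - f t / h t| <= d) ->
  forall s, dominates h phi s ->
    covering f phi <= \sum_(c <- s) c.1 * (f c.2^-1%g / h c.2^-1%g + d).
  move=> [cf' p] fK' H s [/allP s0 ds].
  have -> : \sum_(c <- s) c.1 * (f c.2^-1%g / h c.2^-1%g + d) =
     weight [seq (c.1 * (f c.2^-1%g / h c.2^-1%g + d), c.2) | c <- s].
    by rewrite /weight big_map.
  apply: covering_le; split.
    apply/allP => _ /mapP[c /s0 cs ->] /=; apply: mulr_ge0 cs _.
    by rewrite addr_ge0 ?divr_ge0 // ltW.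
  move=> g; rewrite big_map /=.
  have -> : f g = (f g / h g) * h g.
    have [->|/fK'/hK hg] := eqVneq (f g) 0; first by rewrite mul0r mul0r.
    by rewrite divfK // gt_eqF.
  apply: le_trans (ler_wpM2l (divr_ge0 (p g) (h0 g)) (ds g)) _.
  rewrite mulr_sumr !big_seq; apply: ler_sum => c /s0 c0.
  rewrite mulrCA -mulrA; apply: (ler_wpM2l c0).
  have [->|nz] := eqVneq (phi (g * c.2)%g) 0; first by rewrite !mulr0.
  apply: (ler_wpM2r (phi0 _)).
  have := H _ (sphi _ nz) c.2^-1%g; rewrite mulgK => /ler_normlW.
  by rewrite lerBlDl.
(* As (f1 + f2) / h <= 1, the factors for f1 and f2 add up to at most 1 + 2d. *)
have S s : dominates h phi s ->
    covering f1 phi + covering f2 phi <= (1 + 2 * d) * weight s.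
  move=> ds; apply: le_trans (lerD (dom f1 (conj c1 p1) f1K _ s ds)
    (dom f2 (conj c2 p2) f2K _ s ds)) _; [by move=> v []|by move=> v []|].
  have [/allP s0 _] := ds.
  rewrite -big_split /weight mulr_sumr /= !big_seq; apply: ler_sum => c /s0 c0.
  rewrite -mulrDr [leRHS]mulrC; apply: (ler_wpM2l c0).
  rewrite addrACA -mulrDl (_ : d + d = 2 * d); last by rewrite mulr_natl mulr2n.
  rewrite lerD2r; have [hz|hz] := eqVneq (h c.2^-1%g) 0.
    by rewrite hz invr0 mulr0.
  rewrite ler_pdivrMr ?mul1r; last by rewrite lt_def hz h0.
  by rewrite lerDl mulr_ge0 // ltW.
have d2 : 0 < 1 + 2 * d by rewrite ltr_pwDl // mulr_ge0 // ltW.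
have {}S : covering f1 phi + covering f2 phi <= (1 + 2 * d) * covering h phi.
  rewrite -ler_pdivrMl //; apply: covering_ge => // s /S.
  by rewrite -ler_pdivrMl.
apply: le_trans S _.
have Hh : covering h phi <= covering (fun g =>
  f1 g + f2 g) phi + d * covering psi phi.
  rewrite -(coveringZ (ltW d0) cpsi np); apply: coveringD => //; exact: CcZ.
apply: le_trans (ler_wpM2l (ltW d2) Hh) _.
have HA := covering_trans cf n0 np; have HB := covering_trans cpsi n0 np.
rewrite -/A in HA; rewrite -/B in HB.
set x := covering _ phi in HA *; set y := covering psi phi in HB *.
set z := covering f0 phi in HA HB *.
have z0 : 0 <= z by apply: covering_ge0 => //; case: n0 => -[].
have y0 : 0 <= y by exact: covering_ge0.
apply: (@le_trans _ _ (x + d * (2 * (A * z) + 3 * (B * z)))).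
  have -> : (1 + 2 * d) * (x + d * y) = x + d * (2 * x + (1 + 2 * d) * y) by ring.
  rewrite lerD2l ler_pM2l // lerD //; first by rewrite ler_pM2l.
  by apply: ler_pM => //; [exact: ltW|lra].
rewrite lerD2l.
have -> : d * (2 * (A * z) + 3 * (B * z)) = d * (2 * A + 3 * B) * z by ring.
apply: (ler_wpM2r z0); apply: le_trans de.
by rewrite ler_pM2l // lerDl.
Qed.


(** Compactness of the segment gives a cluster point, and an ultrafilter, containing each set or its
    complement, converges to its cluster points. *)
Lemma ultra_bounded_cvg (I : Type) (F : set_system I) (u : I -> R) (a b : R) :
  UltraFilter F -> (\forall i \near F, a <= u i <= b) ->
  exists l : R, u @ F --> l.
Proof.
move=> FU Fu; have PF : ProperFilter F by exact: ultra_proper.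
have [l [_ cl]] : `[a, b]%classic `&` cluster (u @ F) !=set0.
  apply: (@segment_compact R a b).
  by apply: filterS Fu => i; rewrite /= in_itv.
exists l => B nB.
have [//|FB] := in_ultra_setVsetC (u @^-1` B) FU.
by have [y []] := cl (~` B) B FB nB.
Qed.

Lemma ler_cvg_filter (I : Type) (F : set_system I) (u v : I -> R) (a b : R) :
  ProperFilter F -> u @ F --> a -> v @ F --> b ->
  (\forall i \near F, u i <= v i) -> a <= b.
Proof.
move=> FF ua vb uv; rewrite -subr_ge0.
have H : (fun i => v i - u i) @ F --> b - a by exact: cvgB.
apply: contrapT => /negP; rewrite -ltNge => lt0.
have [i []] : exists i, u i <= v i /\ v i - u i < 0.
  apply: (@filter_ex _ F); apply: filterI uv _.
  by apply: (H [set y | y < 0]); exact: lt_nbhsl.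
by rewrite subr_lt0 ltNge => ->.
Qed.

Lemma haar_functional : exists L : (G -> R) -> R, [/\
  forall f h, Cc f -> Cc h -> L (fun g => f g + h g) = L f + L h,
  forall a f, Cc f -> L (fun g => a * f g) = a * L f,
  forall t f, Cc f -> L (f .* t) = L f,
  forall f, Ccp f -> 0 <= L f &
  forall f, nonneg_nonzero f -> 0 < L f].
Proof.
have [f0 [cf0 f0p _]] := bump filterT.
have n0 : nonneg_nonzero f0 by split=> //; exists 1%g.
(* The bumps whose supports shrink to the identity. An ultrafilter refining this filter makes all
   the bounded quotients [I f] converge simultaneously. *)
pose F : set_system (G -> R) := filter_from (nbhs (1%g : G))
  (fun U => [set phi | nonneg_nonzero phi /\ forall g, phi g != 0 -> U g]).
have FF : ProperFilter F.
  apply: filter_from_proper.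
    apply: filter_from_filter; first by exists setT; exact: filterT.
    move=> U V nU nV; exists (U `&` V); first exact: filterI.
    by move=> phi [np H]; split; split=> // g /H[].
  by move=> U /bump[phi [cp p1 H]]; exists phi; split=> //; split=> //;
    exists 1%g.
have [UF [UU FU]] := ultraFilterLemma FF.
have PUF : ProperFilter UF by exact: ultra_proper.
have nU : \forall phi \near UF, nonneg_nonzero phi.
  by apply: FU; exists setT; [exact: filterT|move=> phi []].
pose I f phi := covering f phi / covering f0 phi.
have cov0 phi : nonneg_nonzero phi -> 0 < covering f0 phi.
  by move=> np; apply: covering_gt0 np f0p; case: cf0.
have I_ge0 f phi : Cc f -> nonneg_nonzero phi -> 0 <= I f phi.
  by move=> cf np; rewrite divr_ge0 ?covering_ge0 //; case: cf0.
have I_le f phi : Cc f -> nonneg_nonzero phi -> I f phi <= covering f f0.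
  move=> cf np; rewrite ler_pdivrMr ?cov0 //; exact: covering_trans.
have I_cvg f : Cc f -> exists l : R, I f @ UF --> l.
  move=> cf; apply: (@ultra_bounded_cvg _ _ _ 0 (covering f f0)).
  by apply: filterS nU => phi np; rewrite I_ge0 //= I_le.
pose P f := lim (I f @ UF).
have P_cvg f : Cc f -> I f @ UF --> P f.
  by move=> /I_cvg[l Hl]; apply: cvgP Hl.
have P_eq f (l : R) : I f @ UF --> l -> P f = l by move=> H; apply: cvg_lim.
have PD f h : Ccp f -> Ccp h -> P (fun g => f g + h g) = P f + P h.
  move=> [cf fp] [ch hp].
  have cfh := CcD cf ch; apply/eqP; rewrite eq_le; apply/andP; split.
    apply: (ler_cvg_filter PUF (P_cvg _ cfh) (cvgD (P_cvg _ cf) (P_cvg _ ch))).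
    apply: filterS nU => phi np /=; rewrite -mulrDl ler_pM2r ?invr_gt0 ?cov0 //.
    exact: coveringD.
  apply/ler_addgt0Pr => e e0.
  apply: (ler_cvg_filter PUF (cvgD (P_cvg _ cf) (P_cvg _ ch)) (cvgD (P_cvg _
    cfh) (cvg_cst e))).
  have [U nbU HU] := covering_almost_additive (conj cf fp) (conj ch hp) n0 e0.
  apply: FU; exists U => // phi [np sphi] /=.
  rewrite -mulrDl ler_pdivrMr ?cov0 // mulrDl divfK ?gt_eqF ?cov0 //.
  exact: HU.
have PZ a f : 0 <= a -> Cc f -> P (fun g => a * f g) = a * P f.
  move=> a0 cf; apply: P_eq.
  have C : (fun phi => a * I f phi) @ UF --> a * P f.
    by apply: cvgM; [exact: cvg_cst|exact: P_cvg].
  apply: cvg_trans C; apply: near_eq_cvg; apply: filterS nU => phi np.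
  by rewrite /I coveringZ // mulrA.
have Pt t f : Cc f -> P (f .* t) = P f.
  move=> cf; apply: P_eq; apply: cvg_trans (P_cvg _ cf).
  apply: near_eq_cvg; apply: filterS nU => phi np.
  by rewrite /I covering_translate.
have P_ge0 f : Cc f -> 0 <= P f.
  move=> cf; apply: (ler_cvg_filter PUF (cvg_cst 0) (P_cvg _ cf)).
  by apply: filterS nU => phi np; exact: I_ge0.
have P_gt0 f : nonneg_nonzero f -> 0 < P f.
  move=> nf; have [[cf _] [g fg]] := nf.
  have c0 : 0 < covering f0 f by apply: covering_gt0 nf f0p; case: cf0.
  (* From (f0 : phi) <= (f0 : f) (f : phi) the quotient [I f phi] is at least the inverse of (f0 :
     f), a bound independent of [phi] that survives in the limit. *)
  apply: (@lt_le_trans _ _ (covering f0 f)^-1); first by rewrite invr_gt0.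
  apply: (ler_cvg_filter PUF (cvg_cst _) (P_cvg _ cf)).
  apply: filterS nU => phi np.
  rewrite ler_pdivlMr ?cov0 // ler_pdivrMl //.
  by apply: covering_trans => //; case: cf0.
pose pos (f : G -> R) g : R := Num.max (f g) 0.
pose neg (f : G -> R) g : R := Num.max (- f g) 0.
have cneg f : Cc f -> Ccp (neg f).
  move=> cf; apply: (Cc_pos (f := fun g => - f g)).
  rewrite (_ : (fun g => - f g) = fun g => -1 * f g); first exact: CcZ.
  by apply/funext => g; rewrite mulN1r.
have posneg f g : f g = pos f g - neg f g.
  by rewrite /pos /neg !maxEle; case: ifP; case: ifP; lra.
pose L f := P (pos f) - P (neg f).
(* The value of [L] does not depend on how [f] is written as a difference of nonnegative functions:
   [pos f + q = p + neg f] and [P] is additive. Linearity follows by choosing convenient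
   decompositions. *)
have LE f p q : Cc f -> Ccp p -> Ccp q -> (forall g, f g = p g - q g) ->
  L f = P p - P q.
  move=> cf cp cq E; apply/eqP; rewrite /L subr_eq addrAC eq_sym subr_eq.
  have cpos := Cc_pos cf; have cn := cneg _ cf.
  rewrite -(PD _ _ cp cn) -(PD _ _ cpos cq); apply/eqP; congr P.
  by apply/funext => g; rewrite -/(pos f g); have := posneg f g; rewrite E;
    move: (pos f g) (neg f g) (p g) (q g) => x1 x2 x3 x4 ?; lra.
have Lp f : Ccp f -> L f = P f.
  move=> [cf fp].
  have z : Ccp (fun g => 0 * f g) by split=> [|g]; [exact: CcZ|rewrite mul0r].
  rewrite (LE f f (fun g => 0 * f g)) //.
    by rewrite PZ // mul0r subr0.
  by move=> g; rewrite mul0r subr0.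
exists L; split.
- move=> f h cf ch.
  have cpf := Cc_pos cf; have cph := Cc_pos ch.
  have cnf := cneg _ cf; have cnh := cneg _ ch.
  have CD p q : Ccp p -> Ccp q -> Ccp (fun g => p g + q g).
    by move=> [cp p0] [cq q0]; split=> [|g]; [exact: CcD|exact: addr_ge0].
  rewrite (LE _ (fun g => pos f g + pos h g) (fun g => neg f g + neg h g)).
  + by rewrite (PD _ _ cpf cph) (PD _ _ cnf cnh) /L; ring.
  + exact: CcD.
  + exact: CD.
  + exact: CD.
  + by move=> g; rewrite posneg (posneg h) ; ring.
- move=> a f cf; have [cp p0] := Cc_pos cf; have [cn neg0] := cneg _ cf.
  have cZ b p : 0 <= b -> Ccp p -> Ccp (fun g => b * p g).
    by move=> b0 [cp' p'0]; split=> [|g]; [exact: CcZ|exact: mulr_ge0].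
  have [a0|a0] := leP 0 a.
    rewrite (LE _ (fun g => a * pos f g) (fun g => a * neg f g)).
    + by rewrite !PZ // /L mulrBr.
    + exact: CcZ.
    + exact: cZ.
    + exact: cZ.
    + by move=> g; rewrite {1}posneg mulrBr.
  have Na0 : 0 <= - a by rewrite oppr_ge0 ltW.
  rewrite (LE _ (fun g => - a * neg f g) (fun g => - a * pos f g)).
  + by rewrite !PZ // /L; ring.
  + exact: CcZ.
  + exact: cZ.
  + exact: cZ.
  + by move=> g; rewrite {1}posneg; ring.
- move=> t f cf; rewrite /L -(Pt t (pos f)) -?(Pt t (neg f)) //.
  + by have [] := cneg _ cf.
  + by have [] := Cc_pos cf.
- by move=> f cf; rewrite Lp //; apply: P_ge0; case: cf.
- by move=> f nf; rewrite Lp; [exact: P_gt0|case: nf].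
Qed.

End HaarFunctional.

(** * Smooth dependence on parameters *)

Section ParametricFunctional.
Context {R : realType} {G : topologicalType} {V : normedModType R}.
Implicit Types (Phi : G -> V -> R) (K : set G) (U : set V).

(* Class C^k in the second variable, with all these derivatives jointly
   continuous. *)
Fixpoint class_Ck_param (k : nat) (U : set V) (Phi : G -> V -> R) : Prop :=
  (forall g x, U x -> {for (g, x), continuous (fun z => Phi z.1 z.2)}) /\
  match k with
  | 0 => True
  | k'.+1 => (forall g x, U x -> differentiable (Phi g) x) /\
             (forall v : V, class_Ck_param k' U (fun g x => 'd (Phi g) x v))
  end.

Lemma class_Ck_param_continuous k U Phi : class_Ck_param k U Phi ->
  forall g x, U x -> {for (g, x), continuous (fun z => Phi z.1 z.2)}.
Proof. by case: k => [|k] []. Qed.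

Lemma class_Ck_param_sub k U A Phi : A `<=` U ->
  class_Ck_param k U Phi -> class_Ck_param k A Phi.
Proof.
move=> AU; elim: k Phi => [|k IH] Phi; first by case=> c _; split=> // g x /AU;
  exact: c.
case=> c [d D]; split; first by move=> g x /AU; exact: c.
by split=> [g x /AU Ux|v]; [exact: (d g x Ux)|exact: (IH _ (D v))].
Qed.

Lemma continuous_slice Phi g x :
  {for (g, x), continuous (fun z => Phi z.1 z.2)} ->
  {for g, continuous (Phi ^~ x)}.
Proof.
move=> c; apply: (@cvg_comp _ _ _ (fun g => (g, x)) (fun z =>
  Phi z.1 z.2) _ (nbhs (g, x))) => //.
by apply: cvg_pair; [exact: cvg_id|exact: cvg_cst].
Qed.

Lemma tube_close Phi K x (e : R) : compact K -> 0 < e ->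
  (forall g, K g -> {for (g, x), continuous (fun z => Phi z.1 z.2)}) ->
  \forall y \near x, forall g, K g -> `|Phi g y - Phi g x| <= e.
Proof.
move=> /compact_near_coveringP k e0 c.
apply: (k V (nbhs x) (fun y g => `|Phi g y - Phi g x| <= e)) => g0 Kg0.
have e2 : 0 < e / 2 by rewrite divr_gt0.
have [[A B] /= [nA nB] AB] := (cvgrPdist_le (fun z : G * V =>
  Phi z.1 z.2) _).1 (c g0 Kg0) _ e2.
exists (A, B) => // -[g y] [/= Ag By].
have H1 := AB (g, y) (conj Ag By);
  have H2 := AB (g, x) (conj Ag (nbhs_singleton nB)).
rewrite /= in H1 H2.
rewrite -(subrKA (Phi g0 x)) (splitr e) (le_trans (ler_normD _ _)) //.
by rewrite lerD // distrC.
Qed.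

Context (L : (G -> R) -> R).
Context (LD : forall f h, Cc f -> Cc h -> L (fun g => f g + h g) = L f + L h)
  (LZ : forall a f, Cc f -> L (fun g => a * f g) = a * L f)
  (L_ge0 : forall f, Ccp f -> 0 <= L f)
  (pos_on : forall K, compact K ->
     exists2 psi : G -> R, Ccp psi & forall g, K g -> 0 < psi g).

Lemma functional_le f h : Cc f -> Cc h -> (forall g, f g <= h g) -> L f <= L h.
Proof.
move=> cf ch fh; have cNf : Cc (fun g => -1 * f g) by exact: CcZ.
have : 0 <= L (fun g => h g + -1 * f g).
  by apply: L_ge0; split=> [|g]; [exact: CcD|rewrite mulN1r subr_ge0].
by rewrite LD // LZ // mulN1r subr_ge0.
Qed.

(** If [psi >= d > 0] on [K], then [|f| <= (e / d) * psi] everywhere, and positivity of [L] gives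
    the bound. The added 1 only makes the constant strictly positive, so that it can be divided
    by. *)
Lemma functional_bound K : compact K -> exists2 C, 0 < C & forall f (e : R),
  Cc f -> 0 <= e -> (forall g, ~ K g -> f g = 0) ->
  (forall g, K g -> `|f g| <= e) -> `|L f| <= C * e.
Proof.
move=> k; have [psi [cpsi psi0] psiK] := pos_on k.
have [d [d0 Kd]] := pos_continuous_on_compact cpsi.1 k psiK.
have Lpsi : 0 <= L psi by exact: L_ge0.
exists (L psi / d + 1); first by rewrite ltr_wpDl // divr_ge0 // ltW.
move=> f e cf e0 f0 fe.
have cpe : Cc (fun g => (e / d) * psi g) by exact: CcZ.
have bnd (a : R) : `|a| = 1 -> a * L f <= (L psi / d + 1) * e.
  move=> a1; rewrite -LZ //.
  apply: (@le_trans _ _ (L (fun g => (e / d) * psi g))); last first.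
    rewrite LZ // mulrDl mul1r (_ : e / d * L psi = L psi / d * e) ?lerDl //.
    by rewrite mulrC mulrA mulrAC.
  apply: functional_le => //; first exact: CcZ.
  move=> g; have [Kg|nKg] := pselect (K g); last first.
    by rewrite f0 // mulr0 mulr_ge0 // divr_ge0 // ltW.
  apply: le_trans (ler_norm _) _; rewrite normrM a1 mul1r.
  apply: le_trans (fe _ Kg) _; rewrite -mulrA ler_peMr //.
  by rewrite ler_pdivlMl // mulr1; exact: Kd.
rewrite ler_norml -lerN2 opprK -mulN1r [X in _ && X](_ : _ = true).
  by rewrite bnd ?normrN ?normr1.
by have := bnd 1; rewrite normr1 mul1r; apply.
Qed.

Lemma functional_dist K : compact K -> exists2 C, 0 < C & forall f h (e : R),
  Cc f -> Cc h -> 0 <= e -> (forall g, ~ K g -> f g = h g) ->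
  (forall g, K g -> `|f g - h g| <= e) -> `|L f - L h| <= C * e.
Proof.
move=> /functional_bound[C C0 HC]; exists C => // f h e cf ch e0 fh0 fhe.
have cNh : Cc (fun g => -1 * h g) by exact: CcZ.
rewrite -mulN1r -LZ // -LD //; apply: HC => // [|g nK|g Kg].
- exact: CcD.
- by rewrite fh0 // mulN1r subrr.
- by rewrite mulN1r fhe.
Qed.

Lemma class_Ck_param_Cc k U Phi K x : compact K -> U x ->
  (forall g, ~ K g -> Phi g x = 0) -> class_Ck_param k U Phi -> Cc (Phi ^~ x).
Proof.
move=> cK Ux P0 CP; split.
  by move=> g; exact/continuous_slice/(class_Ck_param_continuous CP).
by exists K => // g nz; apply: contrapT => nK; move: nz; rewrite P0 ?eqxx.
Qed.

(** Differentiation under [L]. The mean value theorem replaces the increment of [Phi g] by its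
    differential at an intermediate point; that point depends on [g], which is harmless because the
    derivatives are close to those at [x] uniformly over [K]. The basis reduces this to finitely
    many fixed directions. *)
Lemma class_Ck_functional k U Phi K : has_basis V -> open U -> compact K ->
  (forall g x, U x -> ~ K g -> Phi g x = 0) -> class_Ck_param k U Phi ->
  class_Ck k U (fun x => L (Phi ^~ x)).
Proof.
move=> [n [b [l [lc lb]]]] oU cK; have [C C0 HC] := functional_dist cK.
have C00 : C != 0 by rewrite gt_eqF.
elim: k Phi => [|k IH] Phi P0 CP.
  move=> x Ux; apply/cvgrPdist_le => e e0.
  have eC : 0 < e / C by rewrite divr_gt0.
  have T := tube_close cK eC (fun g _ => class_Ck_param_continuous CP Ux).
  have nU : \forall y \near x, U y by exact: open_nbhs_nbhs.
  apply: filterS2 T nU => y T Uy.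
  have cx := class_Ck_param_Cc cK Ux (fun g => P0 g x Ux) CP.
  have cy := class_Ck_param_Cc cK Uy (fun g => P0 g y Uy) CP.
  rewrite -[leRHS](mulfVK C00) mulrC; apply: HC => //; first exact: ltW.
    by move=> g nK; rewrite !P0.
  by move=> g Kg; rewrite distrC T.
case: CP => CPc [dP CP].
have dP0 v g x : U x -> ~ K g -> 'd (Phi g) x v = 0.
  move=> Ux nK.
  have E : \forall y \near x, (fun=> 0) y = Phi g y.
    by apply: filterS (open_nbhs_nbhs (conj oU Ux)) => y Uy; rewrite P0.
  by rewrite (near_eq_diff E (differentiable_cst _ _)) diff_cst.
have Cdv v := IH (fun g x => 'd (Phi g) x v) (fun g x Ux nK =>
  dP0 v g x Ux nK) (CP v).
have cdv v x : U x -> Cc (fun g => 'd (Phi g) x v).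
  by move=> Ux; apply: (class_Ck_param_Cc cK Ux _ (CP v)) => g; exact: dP0.
have cPhi x : U x -> Cc (Phi ^~ x).
  move=> Ux; split; first by move=> g; exact/continuous_slice/CPc.
  by exists K => // g nz; apply: contrapT => nK; move: nz; rewrite P0 ?eqxx.
have dF x : U x -> is_diff x (fun x => L (Phi ^~ x)) (fun v => L (fun g =>
  'd (Phi g) x v)).
  move=> Ux.
  have lin : linear (fun v : V => L (fun g => 'd (Phi g) x v) : R).
    move=> a u v.
    rewrite (_ : (fun g => 'd (Phi g) x (a *: u + v)) =
      fun g => a * 'd (Phi g) x u + 'd (Phi g) x v).
      by rewrite LD ?LZ //; [exact: cdv|apply: CcZ; exact: cdv|exact: cdv].
    by apply/funext => g; rewrite linearP.
  pose df : {linear V -> R} := HB.pack (fun v : V => L (fun g =>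
    'd (Phi g) x v) : R)
    (GRing.isLinear.Build _ _ _ _ _ lin).
  have dfE : (df : V -> R) = fun v => \sum_i l i v * df (b i).
    by apply/funext => v; rewrite [in LHS](lb v) linear_sum;
      apply: eq_bigr => i _; rewrite linearZ.
  apply: (@is_diff_approx _ _ _ _ df).
    rewrite dfE => v; apply: (class_Ck_continuous (k := 0%N) (U := setT)) => //.
    apply: class_Ck_sum => [|i]; first exact: openT.
    apply: class_CkM; [exact: openT|exact: class_Ck_lin|exact: class_Ck_cst].
  move=> e e0.
  have lip i : exists k, 0 < k /\ forall v, `|l i v| <= k * `|v|.
    by have [k' k0 H] := linear_lipschitz (lc i); exists k'.
  pose kk i := projT1 (cid (lip i)).
  have kkP i : 0 < kk i /\ forall v, `|l i v| <= kk i * `|v| by rewrite /kk;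
    case: cid.
  have S0 : 0 < \sum_i kk i + 1.
    by rewrite ltr_wpDl // sumr_ge0 // => i _; rewrite ltW //; case: (kkP i).
  (* With [kk i] a Lipschitz constant of the coordinate [l i], an error [e'] in each basis direction
     adds up to at most [e / C * |h|], and the constant [C] of the functional brings this to
     [e * |h|]. *)
  pose e' := e / C / (\sum_i kk i + 1).
  have e'0 : 0 < e' by rewrite !divr_gt0.
  have T : \forall y \near x, U y /\ forall i g, K g ->
      `|'d (Phi g) y (b i) - 'd (Phi g) x (b i)| <= e'.
    have nU : \forall y \near x, U y by exact: open_nbhs_nbhs.
    apply: filterI nU _; apply: filter_forall => i.
    by apply: (tube_close cK e'0) => g _;
      exact: (class_Ck_param_continuous (CP (b i))).
  have /nbhs_normP[r r0 Br] := T.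
  have N : \forall h \near (0 : V), `|h| < r.
    apply/nbhs_normP; exists r => // h /=; by rewrite sub0r normrN.
  apply: filterS N => h hr.
  have inB (t : R) : 0 <= t <= 1 -> U (x + t *: h) /\ forall i g, K g ->
      `|'d (Phi g) (x + t *: h) (b i) - 'd (Phi g) x (b i)| <= e'.
    move=> /andP[t0 t1]; apply: Br;
      rewrite /= opprD addrA subrr add0r normrN normrZ ger0_norm //.
    by apply: le_lt_trans hr; rewrite ler_piMl.
  have Uxh : U (h + x).
    by have [] := inB 1 (introT andP (conj ler01 (lexx 1)));
      rewrite scale1r addrC.
  rewrite -addrA -opprD /=.
  have cxd := CcD (cPhi _ Ux) (cdv h x Ux).
  rewrite -LD; [|exact: cPhi|exact: cdv].
  have -> : e * `|h| = C * (e / C * `|h|) by rewrite mulrA mulrCA mulfV // mulr1.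
  apply: HC => //; first exact: cPhi.
  - by rewrite mulr_ge0 // divr_ge0 // ltW.
  - by move=> g nK; rewrite dP0 // addr0 !P0.
  move=> g Kg.
  have [t t01 Et] : exists2 t : R, 0 <= t <= 1 &
      Phi g (x + h) - Phi g x = 'd (Phi g) (x + t *: h) h.
    by apply: mvt_line => t t01; apply: dP; have [] := inB t t01.
  rewrite opprD addrA (addrC h) Et.
  have LB (q : {linear V -> R}) : q h = \sum_i l i h * q (b i).
    by rewrite [in LHS](lb h) linear_sum; apply: eq_bigr => i _; rewrite linearZ.
  rewrite 2!LB -sumrB.
  have [_ dB] := inB t t01.
  apply: (@le_trans _ _ (\sum_i kk i * `|h| * e')).
    apply: le_trans (ler_norm_sum _ _ _) _; apply: ler_sum => i _.
    rewrite -mulrBr normrM; apply: ler_pM => //.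
      by have [_] := kkP i; apply.
    exact: dB.
  rewrite -mulr_suml -mulr_suml mulrAC; apply: ler_wpM2r => //.
  rewrite /e' mulrCA ler_piMr ?divr_ge0 ?ltW //.
  by rewrite ltr_pdivrMr // mul1r ltrDl.
split=> [x Ux|v]; first by have [] := dF x Ux.
apply: eq_class_Ck (Cdv v) => // x Ux.
by have [_ E] := dF x Ux; exact: (esym (congr1 (fun h => h v) E)).
Qed.

End ParametricFunctional.

(** * Charts, tangent maps and forms *)

Section Charts.
Context {R : realType} {m : nat} {T : topologicalType}.
Implicit Types (c d : chart R m T).

Lemma cimg_map c p : cdom c p -> cimg c (c p).
Proof. by exists p. Qed.

Lemma cinv_dom c x : cimg c x -> cdom c (cinv c x).
Proof. by move=> [p cp <-]; rewrite cmapK. Qed.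

Lemma cinvK c x : cimg c x -> c (cinv c x) = x.
Proof. by move=> [p cp <-]; rewrite cmapK. Qed.

Lemma open_preimage (X Y : topologicalType) (U : set X) (A : set Y) (f : X -> Y) :
  open U -> open A -> (forall x, U x -> {for x, continuous f}) ->
  open [set x | U x /\ A (f x)].
Proof.
move=> oU oA cf; rewrite openE => x [Ux Afx].
apply: filterI; first exact: open_nbhs_nbhs.
by apply: (cf x Ux); exact: open_nbhs_nbhs.
Qed.

Lemma open_cimg c : open (cimg c).
Proof. exact: cimg_open. Qed.

Lemma open_cimg_preimage c (A : set T) : open A ->
  open [set x | cimg c x /\ A (cinv c x)].
Proof.
by move=> oA; apply: open_preimage => //;
  [exact: open_cimg|exact: cinv_continuous].
Qed.

End Charts.

Section LocalRepresentatives.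
Context {R : realType}.

(** The differential in arbitrary charts; [tangent_map] is the case of the preferred ones. Fixed
    charts are needed because [chart_at p] may jump with [p]. *)
Definition Dloc m1 m2 (T1 T2 : topologicalType) (c : chart R m1 T1)
    (d : chart R m2 T2) (f : T1 -> T2) (p : T1) : 'rV[R]_m1 -> 'rV[R]_m2 :=
  'd (fun x => d (f (cinv c x))) (c p).

Lemma smooth_map_differentiable m1 m2 (T1 T2 : topologicalType)
    (M1 : manifold R m1 T1) (M2 : manifold R m2 T2) (f : T1 ->
      T2) c d p : smooth_map M1 M2 f ->
  atlas M1 c -> atlas M2 d -> cdom c p -> cdom d (f p) ->
  differentiable (fun x => d (f (cinv c x))) (c p).
Proof.
move=> [_ sf] ac ad cp dfp; have [+ _] := sf c d ac ad 1%N; apply.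
by split; [exact: cimg_map|rewrite cmapK].
Qed.

Context {m1 m2 m3 : nat} {T1 T2 T3 : topologicalType}
  (M1 : manifold R m1 T1) (M2 : manifold R m2 T2) (M3 : manifold R m3 T3).

Lemma Dloc_comp (f : T1 -> T2) (g : T2 -> T3) c d e p v :
  smooth_map M1 M2 f -> smooth_map M2 M3 g ->
  atlas M1 c -> atlas M2 d -> atlas M3 e ->
  cdom c p -> cdom d (f p) -> cdom e (g (f p)) ->
  Dloc c e (g \o f) p v = Dloc d e g (f p) (Dloc c d f p v).
Proof.
move=> sf sg ac ad ae cp dp ep.
have df := smooth_map_differentiable sf ac ad cp dp.
have dg := smooth_map_differentiable sg ad ae dp ep.
have E : d (f (cinv c (c p))) = d (f p) by rewrite cmapK.
rewrite -E in dg.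
have N : \forall x \near c p, ((fun y => e (g (cinv d y))) \o (fun x =>
  d (f (cinv c x)))) x = e ((g \o f) (cinv c x)).
  have O : open [set x | cimg c x /\ (f @^-1` cdom d) (cinv c x)].
    apply: open_cimg_preimage; apply: open_comp => [x _|]; last exact: cdom_open.
    by case: sf => cf _; exact: cf.
  have : nbhs (c p) [set x | cimg c x /\ (f @^-1` cdom d) (cinv c x)].
    by apply: open_nbhs_nbhs; split=> //; split;
      [exact: cimg_map|rewrite /= cmapK].
  by apply: filterS => x [_ dx] /=; rewrite cmapK.
rewrite /Dloc (near_eq_diff N (differentiable_comp df dg)) (diff_comp df dg) /=.
by rewrite E.
Qed.

Lemma smooth_map_id : smooth_map M1 M1 id.
Proof.
by split=> [x //|c d ac ad]; exact: (chart_compat ac ad).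
Qed.

Lemma Dloc_id (c : chart R m1 T1) p v : cdom c p -> Dloc c c id p v = v.
Proof.
move=> cp; have N : \forall x \near c p, id x = c (cinv c x).
  have : nbhs (c p) (cimg c).
    by apply: open_nbhs_nbhs; split; [exact: open_cimg|exact: cimg_map].
  by apply: filterS => x /cinvK.
have [_ E] := is_diff_id (V := 'rV[R]_m1) (c p).
by rewrite /Dloc (near_eq_diff N) ?E.
Qed.

Lemma tangent_mapE (f : T1 -> T2) p :
  tangent_map M1 M2 f p = Dloc (chart_at M1 p) (chart_at M2 (f p)) f p.
Proof. by []. Qed.

End LocalRepresentatives.

Section Forms.
Context {R : realType} {m : nat} {T : topologicalType} (M : manifold R m T).
Implicit Types (omega : T -> 'rV[R]_m -> R).

Lemma form_inE omega c p v : cdom c p ->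
  form_in M c omega (c p) v = omega p (Dloc c (chart_at M p) id p v).
Proof. by move=> cp; rewrite /form_in /Dloc cmapK. Qed.

Lemma form_in_chart_at omega p v :
  form_in M (chart_at M p) omega (chart_at M p p) v = omega p v.
Proof.
have cp := chart_at_dom M p.
by rewrite (form_inE omega v cp) (Dloc_id v cp).
Qed.

Lemma form_in_linear omega c x : smooth_form M omega ->
  linear (form_in M c omega x : 'rV[R]_m -> R).
Proof. by move=> [lo _] a u v; rewrite /form_in linearP lo. Qed.

Lemma form_in_sum omega c x (v : 'rV[R]_m) : smooth_form M omega ->
  form_in M c omega x v = \sum_i v 0 i * form_in M c omega x (delta_mx 0 i).
Proof.
move=> so; pose l : {linear 'rV[R]_m ->
  R} := HB.pack (form_in M c omega x : 'rV[R]_m -> R)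
  (GRing.isLinear.Build _ _ _ _ _ (form_in_linear c x so)).
rewrite -[LHS]/(l v) {1}[v]row_sum_delta linear_sum.
by apply: eq_bigr => i _; rewrite linearZ.
Qed.

(** Both sides apply [omega (f p)] to the differential of [f] from [c] to the preferred chart at
    [f p], factored on the left through [d] and on the right through the preferred chart at [p]. *)
Lemma form_in_pullback omega (f : T -> T) c d p v : smooth_map M M f ->
  atlas M c -> atlas M d -> cdom c p -> cdom d (f p) ->
  form_in M d omega (d (f p)) (Dloc c d f p v) =
  omega (f p) (tangent_map M M f p (Dloc c (chart_at M p) id p v)).
Proof.
move=> sf ac ad cp dp.
have sid := smooth_map_id M.
have ap := chart_at_atlas M; have adm := chart_at_dom M.
rewrite (form_inE omega _ dp); apply: (congr1 (omega (f p)));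
  rewrite tangent_mapE.
have E1 := Dloc_comp v sid sf ac (ap p) (ap (f p)) cp (adm p) (adm (f p)).
have E2 := Dloc_comp v sf sid ac ad (ap (f p)) cp dp (adm (f p)).
exact: etrans (esym E2) E1.
Qed.

End Forms.

Section DiffFormulas.
Context {R : realType} {V : normedModType R}.
Implicit Types (f g : V -> R).

Lemma differentiableME f g x : differentiable f x -> differentiable g x ->
  differentiable (fun y => f y * g y) x.
Proof. by move=> df dg; exact: (differentiableM df dg). Qed.

Lemma diffME f g x v : differentiable f x -> differentiable g x ->
  'd (fun y => f y * g y) x v = f x * 'd g x v + g x * 'd f x v.
Proof. by move=> df dg; have := congr1 (fun h => h v) (diffM df dg). Qed.

Lemma differentiable_sumE (I : Type) (r : seq I) (F : I -> V -> R) x :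
  (forall i, differentiable (F i) x) ->
  differentiable (fun y => \sum_(i <- r) F i y) x.
Proof.
move=> dF; elim: r => [|i r IH].
  by rewrite (_ : (fun _ => _) = fun=> 0);
    [exact: differentiable_cst|apply/funext => y; rewrite big_nil].
rewrite (_ : (fun _ => _) = fun y => F i y + \sum_(i <- r) F i y).
  exact: differentiableD.
by apply/funext => y; rewrite big_cons.
Qed.

Lemma diff_sumE (I : Type) (r : seq I) (F : I -> V -> R) x v :
  (forall i, differentiable (F i) x) ->
  'd (fun y => \sum_(i <- r) F i y) x v = \sum_(i <- r) 'd (F i) x v.
Proof.
move=> dF; elim: r => [|i r IH].
  rewrite big_nil (_ : (fun y => _) = fun=> 0); first by rewrite diff_cst.
  by apply/funext => y; rewrite big_nil.
rewrite big_cons -IH -diffDE //; last exact: differentiable_sumE.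
by congr ('d _ x v); apply/funext => y; rewrite big_cons.
Qed.

Lemma is_diff_coord m (F : V -> 'rV[R]_m) x i : differentiable F x ->
  is_diff x (fun y => F y 0 i) (fun v => 'd F x v 0 i).
Proof.
move=> dF.
pose l : {linear 'rV[R]_m -> R} := HB.pack (fun v : 'rV[R]_m => v 0 i : R)
  (GRing.isLinear.Build _ _ _ _ _ (@linear_coord R m i)).
have lc : continuous l by exact: coord_continuous.
have dl : differentiable l (F x) by exact: linear_differentiable.
apply: DiffDef; first exact: (differentiable_comp dF dl).
by rewrite -[fun y => _]/(l \o F) (diff_comp dF dl) diff_lin.
Qed.

Lemma class_Ck_coord m (F : V -> 'rV[R]_m) k U i : open U -> class_Ck k U F ->
  class_Ck k U (fun y => F y 0 i).
Proof.
move=> oU.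
pose l : {linear 'rV[R]_m -> R} := HB.pack (fun v : 'rV[R]_m => v 0 i : R)
  (GRing.isLinear.Build _ _ _ _ _ (@linear_coord R m i)).
by apply: (class_Ck_linl (l := l)) => //; exact: coord_continuous.
Qed.

End DiffFormulas.

(** * Pullback of the exterior derivative *)

Section Pullback.
Context {R : realType} {m : nat} {T : topologicalType} (M : manifold R m T).
Implicit Types (omega : T -> 'rV[R]_m -> R).

Lemma form_in_differentiable omega c x v : smooth_form M omega -> atlas M c ->
  cimg c x -> differentiable (fun y => form_in M c omega y v) x.
Proof. by move=> [_ so] ac cx; have [+ _] := so c ac v 1%N; apply. Qed.

Lemma diff_form_in omega c x v u : smooth_form M omega -> atlas M c ->
  cimg c x -> 'd (fun y => form_in M c omega y v) x u =
  \sum_i v 0 i * 'd (fun y => form_in M c omega y (delta_mx 0 i)) x u.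
Proof.
move=> so ac cx.
have db i : differentiable (fun y => form_in M c omega y (delta_mx 0 i)) x.
  exact: form_in_differentiable.
have dc (k : R) : differentiable (fun=> k) x by exact: differentiable_cst.
rewrite (_ : (fun y => form_in M c omega y v) =
    fun y => \sum_i v 0 i * form_in M c omega y (delta_mx 0 i)).
  rewrite diff_sumE; last by move=> i; exact: (differentiableME (dc _) (db i)).
  apply: eq_bigr => i _; rewrite (diffME u (dc (v 0 i)) (db i)).
  by rewrite (_ : 'd (fun=> v 0 i) x u = 0) ?mulr0 ?addr0 // diff_cst.
by apply/funext => y; exact: form_in_sum.
Qed.

(* From f^* omega = lam omega one gets
   f^* d omega = lam d omega + d lam /\ omega, and the last term vanishes on
   the kernel of omega. *)
Lemma dform_pullback omega (f : T -> T) (lam : T -> R) p u v :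
  smooth_form M omega -> smooth_map M M f ->
  (forall q w, omega (f q) (tangent_map M M f q w) = lam q * omega q w) ->
  (exists e, omega p e != 0) -> omega p u = 0 -> omega p v = 0 ->
  dform M omega (f p) (tangent_map M M f p u) (tangent_map M M f p v) =
  lam p * dform M omega p u v.
Proof.
move=> so sf lamE [e epn0] u0 v0.
set c := chart_at M p; set d := chart_at M (f p).
have ac : atlas M c by exact: chart_at_atlas.
have ad : atlas M d by exact: chart_at_atlas.
have cp : cdom c p by exact: chart_at_dom.
have dp : cdom d (f p) by exact: chart_at_dom.
set x0 := c p; pose F x := d (f (cinv c x)).
have Fx0 : F x0 = d (f p) by rewrite /F /x0 cmapK.
pose O := [set x | cimg c x /\ cdom d (f (cinv c x))].
have oO : open O.
  apply: (@open_cimg_preimage _ _ _ c (f @^-1` cdom d)).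
  by apply: open_comp => [x _|]; [case: sf => cf _; exact: cf|exact: cdom_open].
have Ox0 : O x0 by split; [exact: cimg_map|rewrite /x0 cmapK].
have CF k : class_Ck k O F by case: sf => _; apply.
pose b w y := form_in M d omega y w.
pose a w x := form_in M c omega x w.
have dF x : O x -> differentiable F x by move=> Ox; have [+ _] := CF 1%N; apply.
(* The pullback of omega on the constant field [w]. Its derivative has a term with second
   derivatives of [F], symmetric and hence cancelling in the exterior derivative, and a term with
   the derivative of omega. *)
pose B w x := \sum_i ('d F x w) 0 i * b (delta_mx 0 i) (F x).
have BE w x : O x -> B w x = b ('d F x w) (F x).
  by move=> Ox; rewrite /b form_in_sum.
have H x w : O x -> B w x = lam (cinv c x) * a w x.
  move=> Ox; rewrite BE //; case: Ox => cx dx.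
  have cq : cdom c (cinv c x) by exact: cinv_dom.
  have E1 := form_in_pullback omega w sf ac ad cq dx.
  rewrite lamE -(form_inE M omega w cq) in E1.
  by move: E1; rewrite /Dloc (cinvK cx).
have da w : differentiable (a w) x0.
  by apply: form_in_differentiable => //; exact: cimg_map.
have db w : differentiable (b w) (F x0).
  by rewrite Fx0; apply: form_in_differentiable => //; exact: cimg_map.
have ax0 w : a w x0 = omega p w by exact: form_in_chart_at.
have dBF i : differentiable (fun x => b (delta_mx 0 i) (F x)) x0.
  exact: (differentiable_comp (dF _ Ox0) (db _)).
have dBFE i z : 'd (fun x => b (delta_mx 0 i) (F x)) x0 z =
    'd (b (delta_mx 0 i)) (F x0) ('d F x0 z).
  by have := congr1 (fun h => h z) (diff_comp (dF _ Ox0) (db (delta_mx 0 i))).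
have dTF w : differentiable (fun x => 'd F x w) x0.
  by have [_ /(_ w)[+ _]] := CF 2%N; apply.
have dTFi w i : differentiable (fun x => 'd F x w 0 i) x0.
  by have [] := is_diff_coord i (dTF w).
have dBt w i : differentiable (fun x => 'd F x w 0 i * b (delta_mx 0 i) (F x)) x0.
  exact: (differentiableME (dTFi w i) (dBF i)).
have dB w : differentiable (B w) x0 by exact: differentiable_sumE.
have dBE w z : 'd (B w) x0 z =
   \sum_i b (delta_mx 0 i) (F x0) * 'd (fun x => 'd F x w 0 i) x0 z +
   'd (b ('d F x0 w)) (F x0) ('d F x0 z).
  have E1 : 'd (B w) x0 z = \sum_i 'd (fun x =>
    'd F x w 0 i * b (delta_mx 0 i) (F x)) x0 z.
    exact: (diff_sumE (F := fun i x => 'd F x w 0 i * b (delta_mx 0 i) (F x))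
      (index_enum 'I_m) z (dBt w)).
  have cF : cimg d (F x0) by rewrite Fx0; exact: cimg_map.
  have E3 := diff_form_in ('d F x0 w) ('d F x0 z) so ad cF.
  apply: etrans E1 _; apply: etrans (congr1 _ (esym E3)).
  apply: etrans (big_split _ _ _ _ _).
  apply: eq_bigr => i _; apply: etrans (diffME z (dTFi w i) (dBF i)) _.
  exact: etrans (addrC _ _) (congr1 (fun t => _ + _ * t) (dBFE i z)).
have schwarz i w z : 'd (fun x => 'd F x w 0 i) x0 z = 'd (fun x =>
  'd F x z 0 i) x0 w.
  have C2 : class_Ck 2 O (fun x => F x 0 i) by exact: class_Ck_coord.
  have key w' : \forall x \near x0, 'd (fun x => F x 0 i) x w' = 'd F x w' 0 i.
    have : nbhs x0 O by exact: open_nbhs_nbhs.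
    apply: filterS => x Ox; have [_ E] := is_diff_coord i (dF _ Ox).
    exact: (congr1 (fun h => h w') E).
  have dd w' : differentiable (fun x => 'd (fun x => F x 0 i) x w') x0.
    by have [_ /(_ w')[+ _]] := C2; apply.
  have K w' := near_eq_diff (key w') (dd w').
  apply: etrans (congr1 (fun h => h z) (K w)) _.
  apply: etrans (class_C2_schwarz _ _ oO Ox0 C2) _.
  exact: esym (congr1 (fun h => h w) (K z)).
(* No regularity of [lam] is assumed; near [x0] it agrees in the chart with this quotient, which is
   differentiable. *)
pose ell x := B e x / a e x.
have ae0 : a e x0 != 0 by rewrite ax0.
have dell : differentiable ell x0.
  exact: (differentiableME (dB e) (differentiableV (da e) ae0)).
have near_ell w : \forall x \near x0, ell x * a w x = B w x.
  have N1 : nbhs x0 O by exact: open_nbhs_nbhs.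
  have N2 : \forall x \near x0, a e x != 0.
    have := differentiable_continuous (da e).
    move=> /(_ [set y | y != 0]); apply.
    by apply: open_nbhs_nbhs; split; [exact: open_neq|].
  apply: filterS2 N1 N2 => x Ox ae.
  by rewrite /ell !H // mulfK.
have ell0 : ell x0 = lam p.
  by rewrite /ell H // mulfK // /x0 cmapK.
have key w z : omega p w = 0 ->
    lam p * 'd (a w) x0 z =
    \sum_i b (delta_mx 0 i) (F x0) * 'd (fun x => 'd F x w 0 i) x0 z +
    'd (b ('d F x0 w)) (F x0) ('d F x0 z).
  move=> w0; apply: etrans (dBE w z).
  have dea : differentiable (fun x =>
    ell x * a w x) x0 by exact: (differentiableME dell (da w)).
  have E1 := congr1 (fun h => h z) (near_eq_diff (near_ell w) dea).
  have E2 := diffME z dell (da w).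
  apply: etrans (esym (etrans E1 E2)).
  by rewrite ax0 w0 mul0r addr0 ell0.
have -> : dform M omega (f p) (tangent_map M M f p u) (tangent_map M M f p v) =
    'd (b ('d F x0 v)) (F x0) ('d F x0 u) - 'd (b ('d F x0 u)) (F x0) ('d F x0 v).
  by rewrite Fx0.
have -> : lam p * dform M omega p u v =
    lam p * 'd (a v) x0 u - lam p * 'd (a u) x0 v by exact: mulrBr.
apply: esym; apply: etrans (congr2 (fun s t =>
  s - t) (key v u v0) (key u v u0)) _.
have -> : \sum_i b (delta_mx 0 i) (F x0) * 'd (fun x => 'd F x v 0 i) x0 u =
    \sum_i b (delta_mx 0 i) (F x0) * 'd (fun x => 'd F x u 0 i) x0 v.
  by apply: eq_bigr => i _; exact: (congr1 _ (schwarz i v u)).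
by rewrite opprD addrACA subrr add0r.
Qed.

End Pullback.

(** * Rescaling a pseudo-Hermitian structure *)

Section ContactVolume.
Context {R : comNzRingType}.

(** Composition with the transposition exchanges even and odd permutations. Splitting by parity
    works in every commutative ring, whereas showing that the signed sum is its own opposite would
    leave a factor 2. *)
Lemma alternating_sum0 (I : finType) (a b : I) (Q : {perm I} -> R) : a != b ->
  (forall s, Q (tperm a b * s)%g = Q s) -> 
  \sum_(s : {perm I} | ~~ odd_perm s) Q s - \sum_(s : {perm I} | odd_perm s) Q
    s = 0.
Proof.
move=> ab Qt; rewrite [X in _ - X](reindex_inj (mulgI (tperm a b))) /=.
under [X in _ - X]eq_big => [s|s _] do [rewrite odd_mul_tperm ab|rewrite Qt].
exact: subrr.
Qed.

Lemma signed_sum0 (I : finType) (a b : I) (Q : {perm I} -> R) : a != b ->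
  (forall s, Q (tperm a b * s)%g = Q s) ->
  \sum_(s : {perm I}) (-1) ^+ s * Q s = 0.
Proof.
move=> ab Qt; rewrite (bigID (@odd_perm I)) /= addrC.
rewrite -[RHS](alternating_sum0 ab Qt) -sumrN.
by congr (_ + _); apply: eq_bigr => s; [move=> /negbTE ->|move=> ->];
  rewrite ?expr0 ?expr1 ?mul1r ?mulN1r.
Qed.

Context (n : nat) (w theta : 'I_n.*2.+1 -> R)
  (beta : 'I_n.*2.+1 -> 'I_n.*2.+1 -> R) (h : R).

Let i1 (i : 'I_n) : 'I_n.*2.+1 := inord i.*2.+1.
Let i2 (i : 'I_n) : 'I_n.*2.+1 := inord i.*2.+2.

(* In the expansion of the product every term with a factor
   theta /\ w is alternating in two arguments of w /\ w. *)
Lemma signed_sum_rescale :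
  \sum_(s : {perm 'I_n.*2.+1}) (-1) ^+ s * (h * w (s ord0) *
    \prod_(i < n) (h * beta (s (i1 i)) (s (i2 i)) +
      (theta (s (i1 i)) * w (s (i2 i)) - theta (s (i2 i)) * w (s (i1 i))))) =
  h ^+ n.+1 * \sum_(s : {perm 'I_n.*2.+1}) (-1) ^+ s * (w (s ord0) *
    \prod_(i < n) beta (s (i1 i)) (s (i2 i))).
Proof.
have v1 i : val (i1 i) = i.*2.+1.
  by rewrite /i1 /= inordK // ltnS; have := ltn_ord i; lia.
have v2 i : val (i2 i) = i.*2.+2.
  by rewrite /i2 /= inordK // ltnS; have := ltn_ord i; lia.
pose A (s : {perm 'I_n.*2.+1}) i := h * beta (s (i1 i)) (s (i2 i)).
pose B (s : {perm 'I_n.*2.+1}) i :=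
  theta (s (i1 i)) * w (s (i2 i)) - theta (s (i2 i)) * w (s (i1 i)).
pose P (J : {set 'I_n}) (s : {perm 'I_n.*2.+1}) :=
  \prod_i (if i \in J then A s i else B s i).
have E s : \prod_(i < n) (A s i + B s i) = \sum_(J : {set 'I_n}) P J s.
  exact: bigA_distr.
rewrite (eq_bigr (fun s : {perm 'I_n.*2.+1} =>
  \sum_(J : {set 'I_n}) (-1) ^+ s * (h * w (s ord0) * P J s))) /=; last first.
  by move=> s _; rewrite E !mulr_sumr.
rewrite exchange_big /= (bigD1 (finset.setTfor 'I_n)) //= [X in _ + X]big1
  ?addr0 => [|J JT].
  rewrite mulr_sumr; apply: eq_bigr => s _; rewrite /P.
  under eq_bigr do rewrite finset.in_setT.
  rewrite /A big_split /= prodr_const card_ord exprS.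
  move: (\prod_(i < n) beta _ _) ((-1) ^+ s) (w _) (h ^+ n) => a b c d.
  by ring.
have [i iJ] : exists i, i \notin J.
  apply/existsP; rewrite -negb_forall; apply: contra JT => /forallP H.
  by apply/eqP/finset.setP => i; rewrite finset.in_setT H.
pose Q (s : {perm 'I_n.*2.+1}) :=
  \prod_(j | j != i) (if j \in J then A s j else B s j).
have n01 : ord0 != i1 i by rewrite -val_eqE v1.
have n02 : ord0 != i2 i by rewrite -val_eqE v2.
have n12 : i1 i != i2 i by rewrite -val_eqE /= v1 v2; lia.
have Qt k s : k = i1 i \/ k = i2 i -> Q (tperm ord0 k * s)%g = Q s.
  move=> ki; apply: eq_bigr => j ji.
  have T l : l = i1 j \/ l = i2 j -> (tperm ord0 k * s)%g l = s l.
    move=> lj; rewrite permM tpermD // -val_eqE /=.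
      by case: lj => ->; rewrite ?v1 ?v2.
    move: ji; rewrite -val_eqE /= => ji.
    by case: lj => ->; case: ki => ->; rewrite ?v1 ?v2;
      apply: contra ji => /eqP ?; apply/eqP; lia.
  by rewrite /A /B (T (i1 j) (or_introl erefl)) (T (i2 j) (or_intror erefl)).
transitivity (\sum_(s : {perm 'I_n.*2.+1}) (-1) ^+ s *
     (w (s ord0) * w (s (i2 i)) * (h * theta (s (i1 i)) * Q s)) -
   \sum_(s : {perm 'I_n.*2.+1}) (-1) ^+ s *
     (w (s ord0) * w (s (i1 i)) * (h * theta (s (i2 i)) * Q s))).
  rewrite -sumrB; apply: eq_bigr => s _.
  rewrite /P (bigD1 i) //= (negbTE iJ) -/(Q s) /B -mulrBr; congr (_ * _).
  move: (Q s) (w _) (theta _) (w _) (theta _) (w _) => q a b c d e.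
  by ring.
have n21 : i2 i != i1 i by rewrite eq_sym.
rewrite (signed_sum0 (b := i2 i) n02) => [|s].
  rewrite (signed_sum0 (b := i1 i) n01) ?subrr // => s.
  rewrite Qt; last by left.
  by rewrite !permM tpermL tpermR tpermD // (mulrC (w _) (w (s ord0))).
rewrite Qt; last by right.
by rewrite !permM tpermL tpermR tpermD // (mulrC (w _) (w (s ord0))).
Qed.

End ContactVolume.

Section TangentMaps.
Context {R : realType} {m : nat} {T : topologicalType} (M : manifold R m T).

Lemma tangent_mapP (f : T -> T) p a u v :
  tangent_map M M f p (a *: u + v) =
  a *: tangent_map M M f p u + tangent_map M M f p v.
Proof. exact: linearP. Qed.

Lemma tangent_map0 (f : T -> T) p : tangent_map M M f p 0 = 0.
Proof. exact: linear0. Qed.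

Lemma tangent_map_comp (f g : T -> T) p v :
  smooth_map M M f -> smooth_map M M g ->
  tangent_map M M (f \o g) p v =
  tangent_map M M f (g p) (tangent_map M M g p v).
Proof.
move=> sf sg.
exact: (Dloc_comp v sg sf (chart_at_atlas M p) (chart_at_atlas M (g p))
  (chart_at_atlas M (f (g p))) (chart_at_dom M p) (chart_at_dom M (g p))
  (chart_at_dom M (f (g p)))).
Qed.

Lemma tangent_map_id p v : tangent_map M M id p v = v.
Proof. exact: Dloc_id (chart_at_dom M p). Qed.

End TangentMaps.

Definition smooth_fun (R : realType) (m : nat) (T : topologicalType)
    (M : manifold R m T) (h : T -> R) :=
  forall c, atlas M c -> smooth_on (cimg c) (fun x => h (cinv c x)).

Section Multiplier.
Context {R : realType} {n : nat} {T : topologicalType}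
  (M : manifold R n.*2.+1 T).
Implicit Types (omega eta : T -> 'rV[R]_(n.*2.+1) -> R).

Lemma contact_form_neq0 omega p : contact_form M omega ->
  exists e, omega p e != 0.
Proof.
move=> [_ /(_ p)[e ve]]; apply: contrapT => H.
have w0 v : omega p v = 0 by apply/eqP; apply: contra_notT H => v0; exists v.
move: ve; rewrite /contact_volume big1 ?eqxx // => s _.
by rewrite w0 mul0r mulr0.
Qed.

(* The function lambda with f^* omega = lambda omega, for f preserving the
   kernel of omega; it is read off an arbitrary vector outside the kernel. *)
Definition multiplier omega (f : T -> T) (p : T) : R :=
  let e := xget 0 [set e | omega p e != 0] in
  omega (f p) (tangent_map M M f p e) / omega p e.

Lemma multiplier_unique omega f p (k : R) : contact_form M omega ->
  (forall v, omega (f p) (tangent_map M M f p v) = k * omega p v) ->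
  multiplier omega f p = k.
Proof.
move=> co H; rewrite /multiplier H mulfK //.
exact: (@xgetPex _ 0 [set e | omega p e != 0] (contact_form_neq0 p co)).
Qed.

(** Each [v] is a multiple of [e] plus a kernel vector [u], and the pullback of omega vanishes on
    [u]. *)
Lemma multiplierE omega f p v : contact_form M omega ->
  (forall u, omega p u = 0 -> omega (f p) (tangent_map M M f p u) = 0) ->
  omega (f p) (tangent_map M M f p v) = multiplier omega f p * omega p v.
Proof.
move=> co H; set e := xget 0 [set e | omega p e != 0].
have e0 : omega p e != 0.
  exact: (@xgetPex _ 0 [set e | omega p e != 0] (contact_form_neq0 p co)).
have [[lin _] _] := co.
have lin0 q : omega q 0 = 0.
  by have := lin q 1 0 0; rewrite scaler0 addr0 mul1r => /eqP;
    rewrite -subr_eq0 opprD addrA subrr sub0r oppr_eq0 => /eqP.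
pose u := (- (omega p v / omega p e)) *: e + v.
have u0 : omega p u = 0 by rewrite /u lin mulNr divfK // addNr.
have := H u u0; rewrite /u tangent_mapP lin => /eqP.
rewrite mulNr addrC subr_eq0 => /eqP ->.
by rewrite /multiplier -/e mulrAC [RHS]mulrC mulrA mulrAC.
Qed.

Definition preserves_ker omega f := forall p u,
  omega p u = 0 -> omega (f p) (tangent_map M M f p u) = 0.

Lemma multiplier_comp omega f g p : contact_form M omega ->
  smooth_map M M f -> smooth_map M M g ->
  preserves_ker omega f -> preserves_ker omega g ->
  multiplier omega (f \o g) p = multiplier omega f (g p) * multiplier omega g p.
Proof.
move=> co sf sg kf kg; apply: multiplier_unique => // v.
have -> := tangent_map_comp p v sf sg.
have /= -> := multiplierE (tangent_map M M g p v) co (kf (g p)).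
by rewrite (multiplierE v co (kg p)) mulrA.
Qed.

(** This is where [0 < n] enters: two coordinate vectors are available, and either the first lies in
    the kernel or a combination of both does. *)
Lemma ker_neq0 omega p : (0 < n)%N -> smooth_form M omega ->
  exists2 v, v != 0 & omega p v = 0.
Proof.
move=> n0 [lin _].
have i10 : (1 < n.*2.+1)%N by rewrite ltnS double_gt0.
pose i1 := Ordinal i10.
pose d0 : 'rV[R]_(n.*2.+1) := delta_mx 0 ord0;
  pose d1 : 'rV[R]_(n.*2.+1) := delta_mx 0 i1.
have [E|E] := eqVneq (omega p d0) 0.
  exists d0 => //; apply/eqP => /(congr1 (fun v : 'rV[R]_(n.*2.+1) => v 0 ord0)).
  by rewrite !mxE !eqxx /= => /eqP; rewrite oner_eq0.
exists ((- (omega p d1 / omega p d0)) *: d0 + d1).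
  apply/eqP => /(congr1 (fun v : 'rV[R]_(n.*2.+1) => v 0 i1)).
  by rewrite !mxE !eqxx /= mulr0 add0r => /eqP; rewrite oner_eq0.
by rewrite lin mulNr divfK // addNr.
Qed.

Lemma Aut_CR_preserves_ker omega J f : Aut_CR M (form_ker omega) J f ->
  preserves_ker omega f.
Proof.
move=> [_ TD _] p u u0.
have : form_ker omega (f p) (tangent_map M M f p u).
  by rewrite -TD; exists u.
exact.
Qed.

(** For [v] in the kernel, the Levi form at [f p] on the image of [v] is the multiplier times the
    Levi form at [p] on [v]. Both are positive, since the image of [v] is nonzero by invertibility
    of [f]. *)
Lemma multiplier_gt0 omega J f p : (0 < n)%N -> pseudo_hermitian M omega J ->
  Aut_CR M (form_ker omega) J f -> 0 < multiplier omega f p.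
Proof.
move=> n0 [co [J1 _ _ _] _ _ Jpos] Af.
have kf := Aut_CR_preserves_ker Af.
have [[sf [g [sg fg gf]]] TD PJ] := Af.
have [v vn0 v0] := ker_neq0 p n0 co.1.
have Jv0 : omega p (J p v) = 0 by exact: J1.
have D := dform_pullback co.1 sf (fun q w => multiplierE w co (kf q))
  (contact_form_neq0 p co) Jv0 v0.
rewrite (PJ p v v0) in D.
have Tv0 : form_ker omega (f p) (tangent_map M M f p v) by exact: kf.
have Tvn0 : tangent_map M M f p v != 0.
  apply: contra_neq vn0 => E.
  have := tangent_map_comp p v sg sf.
  rewrite E (_ : g \o f = id); last exact/funext.
  by rewrite tangent_map_id tangent_map0.
have P1 := Jpos _ _ Tv0 Tvn0; rewrite /= D in P1.
by move: P1; rewrite pmulr_lgt0 //; exact: Jpos.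
Qed.

Section Rescaling.
Context (omega : T -> 'rV[R]_(n.*2.+1) -> R) (h : T -> R).
Let eta p v := h p * omega p v.
Context (so : smooth_form M omega) (sh : smooth_fun M h).

Lemma smooth_form_rescale : smooth_form M eta.
Proof.
have [lin smo] := so; split=> [p a u v|c ac v k].
  by rewrite /eta lin mulrDr mulrCA.
apply: (class_CkM (f := fun x => h (cinv c x))); first exact: open_cimg.
  exact: sh.
exact: smo.
Qed.

(** The Leibniz rule d(h omega) = h d omega + dh /\ omega, with [theta] for dh. The last term
    vanishes on pairs of kernel vectors, so the Levi form is merely multiplied by h. *)
Lemma dform_rescale p u v (theta := fun w =>
    'd (fun x => h (cinv (chart_at M p) x)) (chart_at M p p) w : R) :
  dform M eta p u v =
  h p * dform M omega p u v + (theta u * omega p v - theta v * omega p u).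
Proof.
set c := chart_at M p.
have ac : atlas M c by exact: chart_at_atlas.
have cp : cdom c p by exact: chart_at_dom.
have dh : differentiable (fun x => h (cinv c x)) (c p).
  by have [+ _] := sh ac 1%N; apply; exact: cimg_map.
have dw w : differentiable (fun x => form_in M c omega x w) (c p).
  by apply: form_in_differentiable => //; exact: cimg_map.
have E w z : 'd (fun x => form_in M c eta x w) (c p) z =
    h p * 'd (fun x => form_in M c omega x w) (c p) z + omega p w * theta z.
  apply: etrans (diffME z dh (dw w)) _.
  by rewrite cmapK // form_in_chart_at.
rewrite /dform -/c; apply: etrans (congr2 (fun s t => s - t) (E v u) (E u v)) _.
by move: ('d _ _ u) ('d _ _ v) => x y; rewrite /= ; ring.
Qed.

Lemma contact_volume_rescale p e :
  contact_volume M eta p e = h p ^+ n.+1 * contact_volume M omega p e.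
Proof.
pose theta w := 'd (fun x => h (cinv (chart_at M p) x)) (chart_at M p p) w : R.
apply: etrans (signed_sum_rescale (fun i => omega p (e i)) (fun i => theta (e i))
  (fun i j => dform M omega p (e i) (e j)) (h p)).
apply: eq_bigr => s _; congr (_ * (_ * _)).
by apply: eq_bigr => i _; rewrite dform_rescale.
Qed.

Context (h_gt0 : forall p, 0 < h p).

Lemma form_ker_rescale : form_ker eta = form_ker omega.
Proof.
apply/funext => p; apply/seteqP; split=> v; rewrite /form_ker /eta /=.
  by move/eqP; rewrite mulf_eq0 gt_eqF //= => /eqP.
by move=> ->; rewrite mulr0.
Qed.

Lemma pseudo_hermitian_rescale J : pseudo_hermitian M omega J ->
  pseudo_hermitian M eta J.
Proof.
move=> [[_ cv] cJ sym inv pos].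
have [J1 _ _ _] := cJ.
have D p u v : omega p u = 0 -> omega p v = 0 ->
    dform M eta p u v = h p * dform M omega p u v.
  by move=> u0 v0; rewrite dform_rescale u0 v0 !mulr0 subrr addr0.
have K p u : form_ker eta p u -> omega p u = 0 by rewrite form_ker_rescale.
split.
- split; first exact: smooth_form_rescale.
  move=> p; have [e ve] := cv p; exists e.
  by rewrite contact_volume_rescale mulf_neq0 // expf_neq0 // gt_eqF.
- by rewrite form_ker_rescale.
- move=> p u v /K Du /K Dv.
  by rewrite (D p _ _ (J1 _ _ Du) Dv) (D p _ _ (J1 _ _ Dv) Du) (sym _ _ _ Du Dv).
- move=> p u v /K Du /K Dv.
  have JDu := J1 _ _ Du; have JDv := J1 _ _ Dv.
  by rewrite (D p _ _ (J1 _ _ JDu) JDv) (D p _ _ JDu Dv) (inv _ _ _ Du Dv).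
- move=> p u /K Du un0.
  by rewrite (D p _ _ (J1 _ _ Du) Du) mulr_gt0 // pos.
Qed.

Lemma Psh_rescale J f : contact_form M omega -> Aut_CR M (form_ker omega) J f ->
  (forall p, h (f p) * multiplier omega f p = h p) -> Psh M eta J f.
Proof.
move=> co Af hf; have kf := Aut_CR_preserves_ker Af.
case: Af => df _ PJ; split=> //; last by rewrite form_ker_rescale.
by move=> p v; rewrite /eta (multiplierE v co (kf p)) mulrA hf.
Qed.

End Rescaling.
End Multiplier.

Lemma class_Ck_prod (R : realType) (V : normedModType R) k (U : set V) I (s :
  seq I) (F : I -> V -> R) :
  open U -> (forall i, class_Ck k U (F i)) -> class_Ck k U (fun x =>
    \prod_(i <- s) F i x).
Proof.
move=> oU CF; elim: s => [|i s IH].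
  rewrite (_ : (fun _ => _) = fun=> 1); first exact: class_Ck_cst.
  by apply/funext => x; rewrite big_nil.
rewrite (_ : (fun _ => _) = fun x => F i x * \prod_(i <- s) F i x).
  exact: class_CkM.
by apply/funext => x; rewrite big_cons.
Qed.

(** * Cutoff functions and exhaustions *)

Section FlatFunction.
Context {R : realType}.
Implicit Types (t : R).

(* t^(-k) exp(-1/t) for t > 0, extended by 0: a family closed under
   differentiation. *)
Definition flat (k : nat) t : R := if 0 < t then t^-1 ^+ k * expR (- t^-1) else 0.

Lemma flat_ge0 k t : 0 <= flat k t.
Proof.
rewrite /flat; case: ifP => // t0; rewrite mulr_ge0 ?expR_ge0 // exprn_ge0 //.
by rewrite invr_ge0 ltW.
Qed.

Lemma flat0_gt0 t : (0 < flat 0 t) = (0 < t).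
Proof. by rewrite /flat; case: ifP; rewrite ?ltxx // expr0 mul1r expR_gt0. Qed.

(** For t > 0, the term of degree k + 2 of the exponential series at 1/t bounds exp(1/t) from below,
    which explains the factorial. A quadratic bound makes [flat k] differentiable at 0 with zero
    differential. *)
Lemma flat_le_sqr k t : `|flat k t| <= (k.+2)`!%:R * t ^+ 2.
Proof.
rewrite ger0_norm ?flat_ge0 // /flat; case: ifP => [t0|_]; last first.
  by rewrite mulr_ge0 ?sqr_ge0.
have x0 : 0 <= t^-1 by rewrite invr_ge0 ltW.
have tn0 : t != 0 by rewrite gt_eqF.
have := expR_ge1Dxn k.+1 x0 => H.
have {}H : t^-1 ^+ k.+2 <= (k.+2)`!%:R * expR t^-1.
  rewrite -ler_pdivrMl; last by rewrite ltr0n fact_gt0.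
  by rewrite mulrC (le_trans _ H) // lerDr.
rewrite expRN ler_pdivrMr ?expR_gt0 // mulrAC.
rewrite -ler_pdivrMr ?exprn_gt0 //; apply: le_trans H.
by rewrite -exprVn -exprD addn2.
Qed.

Lemma is_diff_expR t : is_diff t (@expR R) (fun v => expR t * v).
Proof.
have d : differentiable (@expR R) t by exact/derivable1_diffP/derivable_expR.
apply: DiffDef => //; rewrite diff1E //; apply/funext => v.
by rewrite -[LHS]/(_ * _) derive1E derive_val mulrC.
Qed.

Lemma is_diff_flat k t :
  is_diff t (flat k) (fun v => (- k%:R * flat k.+1 t + flat k.+2 t) * v).
Proof.
have [t0|t0|<-] := ltgtP 0 t.
- pose F k (s : R) := s^-1 ^+ k * expR (- s^-1).
  have tn0 : t != 0 by rewrite gt_eqF.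
  have di : differentiable (fun s : R => s^-1) t by exact: differentiable_Rinv.
  have diE v : 'd (fun s : R => s^-1) t v = - (t^-1 ^+ 2 * v).
    by rewrite diff_Rinv //= exprVn -[LHS]/(- _ * _) mulNr.
  have dF j : differentiable (F j) t /\
      forall v, 'd (F j) t v = (- j%:R * F j.+1 t + F j.+2 t) * v.
    elim: j => [|j [dj djE]].
      have dN : differentiable (fun s : R => (-1) * s^-1) t.
        exact: (differentiableME (differentiable_cst _ _) di).
      have EN v : 'd (fun s : R => (-1) * s^-1) t v = t^-1 ^+ 2 * v.
        apply: etrans (diffME v (differentiable_cst _ _) di) _.
        by rewrite diff_cst mulr0 addr0 diE mulN1r opprK.
      have [de deE] := is_diff_expR ((-1) * t^-1).
      have E : F 0%N = @expR R \o (fun s : R => (-1) * s^-1).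
        by apply/funext => s; rewrite /F /= expr0 mul1r mulN1r.
      split; first by rewrite E; exact: differentiable_comp.
      move=> v; rewrite E; apply: etrans (congr1 (fun h =>
        h v) (diff_comp dN de)) _.
      apply: etrans (congr1 (fun h => h _) deE) _.
      apply: etrans (congr1 (fun y => expR _ * y) (EN v)) _.
      by rewrite /F mulN1r; ring.
    have E : F j.+1 = fun s => s^-1 * F j s.
      by apply/funext => s; rewrite /F exprS mulrA.
    split; first by rewrite E; exact: (differentiableME di dj).
    move=> v; rewrite E; apply: etrans (diffME v di dj) _.
    by rewrite djE diE /F !exprS -natr1; ring.
  have [dk dkE] := dF k.
  have N : \forall s \near t, F k s = flat k s.
    have : nbhs t [set s : R | 0 < s] by exact: lt_nbhsr.
    by apply: filterS => s s0; rewrite /flat s0.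
  have [D1 D2] := near_eq_is_diff N dk.
  apply: DiffDef => //; rewrite D2; apply/funext => v.
  by rewrite dkE /flat t0.
- have N : \forall s \near t, (fun=> 0) s = flat k s.
    have : nbhs t [set s : R | s < 0] by exact: lt_nbhsl.
    by apply: filterS => s s0; rewrite /flat ltNge ltW.
  have [D1 D2] := near_eq_is_diff N (differentiable_cst _ _).
  apply: DiffDef => //; rewrite D2; apply/funext => v.
  by rewrite diff_cst /flat ltNge ltW //= mulr0 addr0 mul0r.
- have l0 : linear (fun _ : R => 0 : R) by move=> a u v; rewrite scaler0 addr0.
  pose l : {linear R -> R} := HB.pack (fun _ : R => 0 : R)
    (GRing.isLinear.Build _ _ _ _ _ l0).
  have f0 j : flat j 0 = 0 by rewrite /flat ltxx.
  apply: (@is_diff_eq _ _ _ _ l); last first.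
    by apply/funext => v; rewrite !f0 mulr0 addr0 mul0r.
  apply: is_diff_approx; first exact: cst_continuous.
  move=> e e0; have c0 : 0 < (k.+2)`!%:R :> R by rewrite ltr0n fact_gt0.
  have : nbhs (0 : R) [set s : R | `|s| < e / (k.+2)`!%:R].
    apply/nbhs_normP; exists (e / (k.+2)`!%:R); first by rewrite /= divr_gt0.
    by move=> s /=; rewrite sub0r normrN.
  apply: filterS => s /= /ltW se; rewrite addr0 f0 !subr0.
  apply: le_trans (flat_le_sqr k s) _.
  rewrite -normr_id -(ger0_norm (sqr_ge0 s)) normrX expr2 mulrA !normr_id.
  apply: ler_wpM2r => //.
  by rewrite mulrC -ler_pdivlMr.
Qed.

Lemma class_Ck_flat j k : class_Ck j [set: R] (flat k).
Proof.
elim: j k => [|j IH] k.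
  by move=> t _; apply: differentiable_continuous; have [] := is_diff_flat k t.
split=> [t _|v]; first by have [] := is_diff_flat k t.
rewrite (_ : (fun t => 'd (flat k) t v) =
    fun t => (- k%:R * flat k.+1 t + flat k.+2 t) * v).
  apply: class_CkM; [exact: openT| |exact: class_Ck_cst].
  apply: class_CkD => //; first exact: openT.
  apply: class_CkM => //; first exact: openT.
  exact: class_Ck_cst.
by apply/funext => t; have [_ ->] := is_diff_flat k t.
Qed.

End FlatFunction.

Section BoxBump.
Context {R : realType} {m : nat}.
Implicit Types (a x : 'rV[R]_m).

Definition box a (r : R) : set 'rV[R]_m := [set x | forall i,
  a 0 i - r <= x 0 i <= a 0 i + r].

Lemma box_compact a r : compact (box a r).
Proof.
have := @rV_compact R m (fun i => `[a 0 i - r, a 0 i + r]%classic)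
  (fun i => @segment_compact R _ _).
congr compact; apply/seteqP; split=> x H i; have := H i; by rewrite /= in_itv.
Qed.

Lemma box_nbhs a (U : set 'rV[R]_m) : nbhs a U ->
  exists2 r, 0 < r & box a r `<=` U.
Proof.
move=> /nbhs_ballP[e e0 aU]; exists (e / 2); first by rewrite divr_gt0.
move=> x bx; apply: aU; split=> // i j; rewrite ord1.
rewrite /ball /= ; have := bx j => /andP[b1 b2].
have ee : e / 2 < e by rewrite ltr_pdivrMr // ltr_pMr // ltr1n.
by apply: le_lt_trans ee; rewrite ler_distl; apply/andP; split; lra.
Qed.

(** For [r > 0] the factor at [i] is positive exactly when the i-th coordinates differ by less than
    [r]; squaring keeps the argument of [flat 0] polynomial. *)
Definition box_bump a (r : R) x : R :=
  \prod_i flat 0 (r ^+ 2 - (x 0 i - a 0 i) ^+ 2).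

Lemma box_bump_ge0 a r x : 0 <= box_bump a r x.
Proof. by apply: prodr_ge0 => i _; exact: flat_ge0. Qed.

Lemma box_bump_gt0 a r : 0 < r -> 0 < box_bump a r a.
Proof.
move=> r0; apply: prodr_gt0 => i _.
by rewrite subrr expr0n subr0 flat0_gt0 exprn_gt0.
Qed.

Lemma box_bump_supp a r x : 0 < r -> box_bump a r x != 0 -> box a r x.
Proof.
move=> r0 /prodf_neq0 H i; have := H i isT.
have := flat_ge0 0 (r ^+ 2 - (x 0 i - a 0 i) ^+ 2); rewrite le_eqVlt eq_sym.
move=> /orP[->//|]; rewrite flat0_gt0 subr_gt0 => lt _.
have : `|x 0 i - a 0 i| <= r.
  by rewrite -ler_sqr ?nnegrE ?(ltW r0) // real_normK ?num_real // ltW.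
by rewrite ler_distl.
Qed.

Lemma smooth_box_bump a r : smooth_on [set: 'rV[R]_m] (box_bump a r).
Proof.
move=> k; apply: class_Ck_prod => [|i]; first exact: openT.
apply: (class_Ck_comp (A := [set: R]) (f := fun x : 'rV[R]_m =>
  r ^+ 2 - (x 0 i - a 0 i) ^+ 2)) => //.
- exact: has_basis_real.
- exact: openT.
- have oT := @openT 'rV[R]_m.
  have Cx : class_Ck k [set: 'rV[R]_m] (fun x => x 0 i - a 0 i).
    apply: class_CkD => //; last exact: class_Ck_cst.
    by apply: class_Ck_coord => //; exact: class_Ck_id.
  rewrite (_ : (fun _ => _) = fun x : 'rV[R]_m =>
    r ^+ 2 + (-1) * ((x 0 i - a 0 i) * (x 0 i - a 0 i))).
    apply: class_CkD => //; first exact: class_Ck_cst.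
    apply: class_CkM => //; first exact: class_Ck_cst.
    exact: class_CkM.
  by apply/funext => x; rewrite mulN1r expr2.
- exact: class_Ck_flat.
Qed.

End BoxBump.

Section ManifoldBumps.
Context {R : realType} {m : nat} {T : topologicalType} (M : manifold R m T).

Lemma smooth_fun_continuous (h : T -> R) : smooth_fun M h -> continuous h.
Proof.
move=> sh p; set c := chart_at M p.
have cp : cdom c p by exact: chart_at_dom.
have C := sh c (chart_at_atlas M p) 0%N (c p) (cimg_map cp).
have C2 : {for p, continuous ((fun x => h (cinv c x)) \o c)}.
  by apply: continuous_comp; [exact: cmap_continuous|exact: C].
apply: near_eq_continuous C2.
have : nbhs p (cdom c) by apply: open_nbhs_nbhs; split => //; exact: cdom_open.
by apply: filterS => q cq /=; rewrite cmapK.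
Qed.

Lemma smooth_fun_open_pos (h : T -> R) : smooth_fun M h -> open [set p | 0 < h p].
Proof.
move=> /smooth_fun_continuous ch.
exact: (@open_comp _ _ h [set y | 0 < y] (fun p _ => ch p) (@open_gt R 0)).
Qed.

(** A box bump in the chart at [q], extended by zero. In another chart it is smooth over the domain
    of the first one, and zero off [C]; these two open sets cover everything because [C] is compact
    in a Hausdorff space, hence closed, and lies in that domain. *)
Lemma manifold_bump (q : T) (W : set T) : nbhs q W ->
  exists chi : T -> R, [/\ smooth_fun M chi, forall p, 0 <= chi p, 0 < chi q &
    exists C, [/\ compact C, C `<=` W & forall p, chi p != 0 -> C p]].
Proof.
move=> qW; set c := chart_at M q.
have ac : atlas M c by exact: chart_at_atlas.
have cq : cdom c q by exact: chart_at_dom.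
have N : nbhs (c q) (cimg c `&` (cinv c @^-1` W)).
  apply: filterI; first by apply: open_nbhs_nbhs; split;
    [exact: open_cimg|exact: cimg_map].
  have := cinv_continuous (cimg_map cq); apply; by rewrite cmapK.
have [r r0 Br] := box_nbhs N.
pose C := cinv c @` box (c q) r.
have cC : compact C.
  have H : {within box (c q) r, continuous (cinv c)}.
    apply: continuous_in_subspaceT => x /set_mem /Br[cx _].
    exact: cinv_continuous.
  exact: (continuous_compact H (@box_compact R m (c q) r)).
have clC : closed C by apply: compact_closed => //; exact: mfd_hausdorff M.
pose chi p : R := if p \in cdom c then box_bump (c q) r (c p) else 0.
have chiC p : chi p != 0 -> C p.
  rewrite /chi; case: ifP => [/set_mem cp|]; last by rewrite eqxx.
  by move=> /(box_bump_supp r0) bx; exists (c p) => //; rewrite cmapK.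
exists chi; split.
- move=> d ad k; apply: class_Ck_local => x dx.
  have [cx|ncx] := pselect (cdom c (cinv d x)).
    exists [set y | cimg d y /\ cdom c (cinv d y)] => //.
    have oA : open [set y | cimg d y /\ cdom c (cinv d y)].
      by apply: open_cimg_preimage; exact: cdom_open.
    apply: (@eq_class_Ck _ _ _ _ _ (box_bump (c q) r \o (fun y =>
      c (cinv d y)))) => //.
      by move=> y [_ cy]; rewrite /chi mem_set.
    apply: (@class_Ck_comp _ _ _ _ _ _ setT) => //; first exact: has_basis_rV.
      exact: (chart_compat ad ac).
    exact: smooth_box_bump.
  exists [set y | cimg d y /\ (~` C) (cinv d y)].
    split=> // -[y /Br[cy _] yx]; apply: ncx; rewrite -yx; exact: cinv_dom.
  have oA : open [set y | cimg d y /\ (~` C) (cinv d y)].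
    by apply: open_cimg_preimage; exact: closed_openC.
  apply: (@eq_class_Ck _ _ _ _ _ (fun=> 0)) => //; last exact: class_Ck_cst.
  by move=> y [_ nC]; apply/esym/eqP; apply: contra_notT nC => /chiC.
- by move=> p; rewrite /chi; case: ifP => // _; exact: box_bump_ge0.
- by rewrite /chi mem_set // box_bump_gt0.
- by exists C; split=> // _ [x /Br[_ Wx] <-].
Qed.

Lemma compact_nbhs_exists (q : T) : exists2 C, compact C & nbhs q C.
Proof.
have [chi [sc _ chiq [C [cC _ chiC]]]] := manifold_bump (q := q) filterT.
exists C => //.
have : nbhs q [set p | 0 < chi p].
  by apply: open_nbhs_nbhs; split=> //; exact: smooth_fun_open_pos sc.
by apply: filterS => p pp; apply: chiC; rewrite gt_eqF.
Qed.

Lemma compact_thicken (K : set T) : compact K ->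
  exists2 C, compact C & K `<=` interior C.
Proof.
move=> k; apply: (compact_ind (P := fun K =>
  exists2 C, compact C & K `<=` interior C) k).
- by exists set0; [exact: compact0|].
- by move=> A B AB [C cC BC]; exists C => //; exact: subset_trans BC.
- move=> A B [C cC AC] [D cD BD]; exists (C `|` D); first exact: compactU.
  move=> x [/AC|/BD] H; apply: filterS H => y; [by left|by right].
- move=> x _; have [C cC xC] := compact_nbhs_exists x.
  by exists (interior C); [exact: nbhs_interior|exists C].
Qed.

Lemma smooth_funD (f g : T -> R) : smooth_fun M f -> smooth_fun M g ->
  smooth_fun M (fun p => f p + g p).
Proof.
move=> sf sg c ac k; apply: (class_CkD (f := fun x => f (cinv c x)));
  first exact: open_cimg.
  exact: sf.
exact: sg.
Qed.

Lemma smooth_bump_compact (K W : set T) : compact K -> open W -> K `<=` W ->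
  exists chi : T -> R, [/\ smooth_fun M chi, forall p, 0 <= chi p,
    forall p, K p -> 0 < chi p &
    exists C, [/\ compact C, C `<=` W & forall p, chi p != 0 -> C p]].
Proof.
move=> k oW KW.
pose Q (K : set T) := exists chi : T ->
  R, [/\ smooth_fun M chi, forall p, 0 <= chi p,
    forall p, K p -> 0 < chi p &
    exists C, [/\ compact C, C `<=` W & forall p, chi p != 0 -> C p]].
apply: (compact_ind (P := Q) k).
- exists (fun=> 0); split=> //; first by move=> c ac j; exact: class_Ck_cst.
  by exists set0; split=> //; [exact: compact0|move=> p; rewrite eqxx].
- by move=> A B AB [chi [a b c d]]; exists chi; split=> // p /AB/c.
- move=> A B [f [sf f0 fA [C [cC CW fC]]]] [g [sg g0 gB [D [cD DW gD]]]].
  exists (fun p => f p + g p); split.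
  + exact: smooth_funD.
  + by move=> p; rewrite addr_ge0.
  + by move=> p [/fA|/gB] lt; [exact: ltr_pwDl|exact: ltr_wpDl].
  + exists (C `|` D); split; [exact: compactU|by move=> p [/CW|/DW]|].
    move=> p; have [->|/fC ? _] := eqVneq (f p) 0; last by left.
    by rewrite add0r => /gD; right.
- move=> x /KW Wx; have [chi [sc c0 cx S]] :=
  manifold_bump (open_nbhs_nbhs (conj oW Wx)).
  exists [set p | 0 < chi p]; last by exists chi.
  by apply: open_nbhs_nbhs; split=> //; exact: smooth_fun_open_pos sc.
Qed.

(** Enumerate a countable base and choose for each member a compact set containing it, or the empty
    set if there is none. [K j.+1] thickens the union of [K j] and the j-th choice; each point is
    reached through a base member inside a compact neighbourhood. *)
Lemma compact_exhaustion : exists K : nat -> set T,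
  [/\ K 0 = set0, forall j, compact (K j),
      forall j, K j `<=` interior (K j.+1) & forall p, exists j, K j p].
Proof.
have [B cB [oB bB]] := mfd_second_countable M.
have [f fB] : exists f : nat -> set T, forall b, B b -> exists j, f j = b.
  have /countable_injP[i iinj] := cB.
  exists (fun j => xget set0 [set b | B b /\ i b = j]) => b Bb; exists (i b).
  have : (exists b', [set b' | B b' /\ i b' = i b] b') by exists b.
  move=> /(xgetPex set0) /= [Bb' /iinj E]; apply: E; exact/mem_set.
pose good (b C : set T) := compact C /\ b `<=` C.
pose C j : set T := xget set0 (good (f j)).
have cC j : compact (C j).
  rewrite /C; case: xgetP => [D -> []//|_]; exact: compact0.
have thick (A : set T) : exists C, compact A -> compact C /\ A `<=` interior C.
  have [cA|nA] := pselect (compact A); last by exists set0.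
  by have [D cD AD] := compact_thicken cA; exists D.
pose th A := projT1 (cid (thick A)).
have thP A : compact A -> compact (th A) /\ A `<=` interior (th A).
  by rewrite /th; case: cid.
pose K := fix K j := match j with 0 => set0 | j'.+1 => th (K j' `|` C j') end.
have cK j : compact (K j).
  elim: j => [|j IH]; first exact: compact0.
  by have [] := thP (K j `|` C j) (compactU IH (cC j)).
exists K; split=> // [j|p].
  have [_ H] := thP (K j `|` C j) (compactU (cK j) (cC j)).
  by move=> x Kx; apply: H; left.
have [D cD pD] := compact_nbhs_exists p.
have [b [Bb bp] bD] := bB p D pD.
have [j fj] := fB b Bb; exists j.+1.
have [_ H] := thP (K j `|` C j) (compactU (cK j) (cC j)).
apply: interior_subset; apply: H; right.
have : good (f j) (C j) by apply: xgetPex; exists D; split=> //; rewrite fj.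
by move=> [_]; apply; rewrite fj.
Qed.

End ManifoldBumps.

(** * Averaging over a proper action *)

Section ParametricCharts.
Context {R : realType} {k m : nat} {G : topologicalType}.
Implicit Types (Psi : 'rV[R]_k * 'rV[R]_m -> R).

Lemma is_diff_slice (W : normedModType R) (F : 'rV[R]_k * 'rV[R]_m ->
  W) a x : differentiable F (a, x) ->
  is_diff x (fun y => F (a, y)) (fun v => 'd F (a, x) (0, v)).
Proof.
move=> dF; have I := is_diff_pair (is_diff_cst a x) (is_diff_id x).
exact: (is_diff_comp I (differentiableP dF)).
Qed.

(** A derivative of [Phi g] in [x] is a derivative of [Psi] along some [(0, v)], so it again has a
    representative in a chart of [G]: the hypothesis is stable under differentiation, and only joint
    continuity remains to be proved. *)
Lemma class_Ck_param_chart j (U : set 'rV[R]_m) (Phi : G -> 'rV[R]_m -> R) :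
  (forall g0 x0, U x0 -> exists (c : chart R k G) (O : set ('rV[R]_k *
    'rV[R]_m)) Psi,
     [/\ cdom c g0, open O, O (c g0, x0), class_Ck j O Psi &
         forall g x, cdom c g -> O (c g, x) -> Phi g x = Psi (c g, x)]) ->
  class_Ck_param j U Phi.
Proof.
have near_pair (c : chart R k G) (O : set ('rV[R]_k * 'rV[R]_m)) (g0 : G) (x0 :
  'rV[R]_m) :
    cdom c g0 -> open O -> O (c g0, x0) ->
    \forall z \near (g0, x0), cdom c z.1 /\ O (c z.1, z.2).
  move=> cg oO Og; apply: filterI.
    apply: (@cvg_fst _ _ (nbhs g0) (nbhs x0) _ (cdom c)).
    by apply: open_nbhs_nbhs; split=> //; exact: cdom_open.
  have C : (fun z : G * 'rV[R]_m => (c z.1, z.2)) @ (g0, x0) --> (c g0, x0).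
    apply: (@cvg_pair _ _ _ _ (nbhs (c g0)) (nbhs x0)); last exact: cvg_snd.
    by apply: (@cvg_comp _ _ _ fst c _ (nbhs g0));
      [exact: cvg_fst|exact: cmap_continuous].
  by apply: C; exact: open_nbhs_nbhs.
have cont Phi' : (forall g0 x0, U x0 ->
  exists (c : chart R k G) (O : set ('rV[R]_k * 'rV[R]_m)) Psi,
     [/\ cdom c g0, open O, O (c g0, x0), class_Ck 0 O Psi &
         forall g x, cdom c g -> O (c g, x) -> Phi' g x = Psi (c g, x)]) ->
    forall g x, U x -> {for (g, x), continuous (fun z => Phi' z.1 z.2)}.
  move=> H g0 x0 /(H g0)[c [A [Psi [cg oO Og CP E]]]].
  apply: (@near_eq_continuous _ _ (fun z => Psi (c z.1, z.2))).
    by apply: filterS (near_pair c A g0 x0 cg oO Og) => z [cz Oz]; rewrite E.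
  apply: (@continuous_comp _ _ _ (fun z : G * 'rV[R]_m => (c z.1, z.2)) Psi).
    apply: (@cvg_pair _ _ _ _ (nbhs (c g0)) (nbhs x0)); last exact: cvg_snd.
    by apply: (@cvg_comp _ _ _ fst c _ (nbhs g0));
      [exact: cvg_fst|exact: cmap_continuous].
  exact: (CP (c g0, x0) Og).
elim: j Phi => [|j IH] Phi H; first by split=> //; exact: cont.
have deriv (c : chart R k G) (O : set ('rV[R]_k * 'rV[R]_m)) Psi g x :
    open O -> class_Ck j.+1 O Psi ->
    (forall g x, cdom c g -> O (c g, x) -> Phi g x = Psi (c g, x)) ->
    cdom c g -> O (c g, x) ->
    is_diff x (Phi g) (fun v => 'd Psi (c g, x) (0, v)).
  move=> oO [dPsi _] E cg Og; have [D1 D2] := is_diff_slice (dPsi _ Og).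
  have N : \forall y \near x, Psi (c g, y) = Phi g y.
    have C : (fun y : 'rV[R]_m => (c g, y)) @ x --> (c g, x).
      have [I _] := is_diff_pair (is_diff_cst (c g) x) (is_diff_id x).
      exact: (differentiable_continuous I).
    have : \forall y \near x, O (c g, y) by apply: C; exact: open_nbhs_nbhs.
    by apply: filterS => y Oy; rewrite E.
  by rewrite -D2; exact: near_eq_is_diff.
split; last split.
- apply: cont => g0 x0 /(H g0)[c [A [Psi [cg oO Og CP E]]]].
  exists c, A, Psi; split=> // z Oz; exact: class_Ck_continuous CP Oz.
- move=> g x /(H g)[c [A [Psi [cg oO Og CP E]]]].
  by have [] := deriv c A Psi g x oO CP E cg Og.
- move=> v; apply: IH => g0 x0 /(H g0)[c [A [Psi [cg oO Og CP E]]]].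
  exists c, A, (fun z => 'd Psi z (0, v)); split=> //; first by case: CP => _;
    apply.
  move=> g x cg' Og'; have [_ D] := deriv c A Psi g x oO CP E cg' Og'.
  exact: (congr1 (fun h => h v) D).
Qed.

End ParametricCharts.

Section SmoothAction.
Context {R : realType} {n k : nat} {T : topologicalType}
  (M : manifold R n.*2.+1 T) {G : topologicalSpaceGroupType} (S : manifold R k G)
  (act : G -> T -> T) (act_smooth : smooth_map2 S M M act)
  (act_smooth1 : forall g, smooth_map M M (act g)).
Context (omega : T -> 'rV[R]_(n.*2.+1) ->
  R) (omega_contact : contact_form M omega)
  (act_ker : forall g, preserves_ker M omega (act g)).

Lemma open_action_domain (c1 : chart R k G) (c d : chart R n.*2.+1 T) :
  open [set z : 'rV[R]_k * 'rV[R]_n.*2.+1 |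
    [/\ cimg c1 z.1, cimg c z.2 & cdom d (act (cinv c1 z.1) (cinv c z.2))]].
Proof.
rewrite openE => -[a x] [/= ca cx dx].
have C : (fun z : 'rV[R]_k * 'rV[R]_n.*2.+1 =>
  act (cinv c1 z.1) (cinv c z.2)) @ (a, x)
    --> act (cinv c1 a) (cinv c x).
  apply: (@cvg_comp _ _ _ (fun z : 'rV[R]_k * 'rV[R]_n.*2.+1 =>
    (cinv c1 z.1, cinv c z.2))
    (fun z : G * T => act z.1 z.2) _ (nbhs (cinv c1 a, cinv c x))); last first.
    by case: act_smooth => H _; exact: (H (cinv c1 a, cinv c x)).
  apply: (@cvg_pair _ _ _ _ (nbhs (cinv c1 a)) (nbhs (cinv c x))).
    by apply: (@cvg_comp _ _ _ fst (cinv c1) _ (nbhs a));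
      [exact: cvg_fst|exact: cinv_continuous].
  by apply: (@cvg_comp _ _ _ snd (cinv c) _ (nbhs x));
    [exact: cvg_snd|exact: cinv_continuous].
have N1 : \forall z \near (a, x), cimg c1 z.1.
  apply: (@cvg_fst _ _ (nbhs a) (nbhs x) _ (cimg c1)).
  by apply: open_nbhs_nbhs; split=> //; exact: open_cimg.
have N2 : \forall z \near (a, x), cimg c z.2.
  apply: (@cvg_snd _ _ (nbhs a) (nbhs x) _ (cimg c)).
  by apply: open_nbhs_nbhs; split=> //; exact: open_cimg.
have N3 : \forall z \near (a, x), cdom d (act (cinv c1 z.1) (cinv c z.2)).
  by apply: C; apply: open_nbhs_nbhs; split=> //; exact: cdom_open.
by apply: filterS3 N1 N2 N3 => z.
Qed.

Lemma form_in_neq0 c p : atlas M c -> cdom c p ->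
  exists e, form_in M c omega (c p) e != 0.
Proof.
move=> ac cp; have [e0 e0P] := contact_form_neq0 p omega_contact.
have sid := smooth_map_id M.
have ap := chart_at_atlas M p; have adm := chart_at_dom M p.
exists (Dloc (chart_at M p) c id p e0).
rewrite (form_inE M omega _ cp).
have E := Dloc_comp e0 sid sid ap ac ap adm cp adm.
have E2 : Dloc c (chart_at M p) id p (Dloc (chart_at M p) c id p e0) = e0.
  exact: etrans (esym E) (Dloc_id e0 adm).
by rewrite E2.
Qed.

(** The definition of [multiplier] picks its vector separately at each point. Near a given pair the
    multiplier is also a quotient taken on one constant coordinate vector [e]: omega on the
    derivative of the action along [e], divided by omega on [e], which is nonzero nearby. *)
Lemma class_Ck_multiplier_param j c (chi : T -> R) : atlas M c ->
  smooth_fun M chi ->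
  class_Ck_param j (cimg c) (fun g x =>
    multiplier M omega (act g) (cinv c x) * chi (act g (cinv c x))).
Proof.
move=> ac schi; apply: (class_Ck_param_chart (k := k)) => g0 x0 cx0.
set p0 := cinv c x0.
have cp0 : cdom c p0 by exact: cinv_dom.
set c1 := chart_at S g0; set d := chart_at M (act g0 p0).
have ac1 : atlas S c1 by exact: chart_at_atlas.
have ad : atlas M d by exact: chart_at_atlas.
have cg0 : cdom c1 g0 by exact: chart_at_dom.
have dq0 : cdom d (act g0 p0) by exact: chart_at_dom.
have [e] := form_in_neq0 ac cp0; rewrite (cinvK cx0) => e0.
pose O' := [set z : 'rV[R]_k * 'rV[R]_n.*2.+1 |
    [/\ cimg c1 z.1, cimg c z.2 & cdom d (act (cinv c1 z.1) (cinv c z.2))]].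
have oO' : open O' by exact: open_action_domain.
pose F (z : 'rV[R]_k * 'rV[R]_n.*2.+1) := d (act (cinv c1 z.1) (cinv c z.2)).
have CF i : class_Ck i O' F by case: act_smooth => _; apply.
pose a (z : 'rV[R]_k * 'rV[R]_n.*2.+1) := form_in M c omega z.2 e.
have [[_ so] _] := omega_contact.
have Ca i : class_Ck i O' a.
  apply: (@class_Ck_comp _ _ _ _ _ _ (cimg c) snd (fun x =>
    form_in M c omega x e)) => //.
  - exact: has_basis_rV.
  - by move=> z [].
  - have Ls : linear (snd : 'rV[R]_k * 'rV[R]_n.*2.+1 ->
    'rV[R]_n.*2.+1) by move=> s u v.
    pose ls : {linear ('rV[R]_k * 'rV[R]_n.*2.+1)%type -> 'rV[R]_n.*2.+1} :=
      HB.pack (snd : 'rV[R]_k * 'rV[R]_n.*2.+1 ->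
        'rV[R]_n.*2.+1) (GRing.isLinear.Build _ _ _ _ _ Ls).
    by apply: (@class_Ck_lin _ _ _ i O' ls) => z; exact: cvg_snd.
  - exact: so.
pose O := [set z | O' z /\ [set y : R | y != 0] (a z)].
have oO : open O.
  apply: (open_preimage oO' (@open_neq R 0)).
  by move=> z Oz; exact: (Ca 0%N z Oz).
have OO' : O `<=` O' by move=> z [].
pose Psi z := (\sum_i ('d F z (0,
  e)) 0 i * form_in M d omega (F z) (delta_mx 0 i)) *
   (a z)^-1 * chi (cinv d (F z)).
exists c1, O, Psi; split=> //.
- split; last by [].
  by split; [exact: cimg_map|exact: cx0|rewrite cmapK].
- have CFO i : class_Ck i O F by exact: class_Ck_sub OO' (CF i).
  have imgF z : O z -> cimg d (F z) by move=> [[_ _ dz] _]; exact: cimg_map.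
  have CI : class_Ck j O (fun z => (a z)^-1).
    exact: (@class_CkV _ _ j O a oO (fun z Oz => Oz.2) (class_Ck_sub OO' (Ca j))).
  have Cchi : class_Ck j O ((fun y => chi (cinv d y)) \o F).
    apply: (class_Ck_comp (A := cimg d) (has_basis_rV _) oO imgF (CFO j)).
    exact: (schi d ad j).
  have CS i : class_Ck j O (fun z =>
    ('d F z (0, e)) 0 i * form_in M d omega (F z) (delta_mx 0 i)).
    apply: (class_CkM oO).
      by apply: (class_Ck_coord _ oO); have [_] := CFO j.+1; apply.
    apply: (class_Ck_comp (g := fun y => form_in M d omega y (delta_mx 0 i))
      (A := cimg d) (has_basis_rV _) oO imgF (CFO j)).
    exact: (so d ad).
  exact: (class_CkM oO (class_CkM oO (class_Ck_sum _ oO CS) CI) Cchi).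
move=> g x cg Og; set p := cinv c x.
have [[/= _ cx]] := Og; rewrite (cmapK cg) -/p => dp ax.
have cp : cdom c p by exact: cinv_dom.
have dF : differentiable F (c1 g, x).
  by have [+ _] := CF 1%N; apply; exact: OO'.
have [_ D] := is_diff_slice dF.
have FE y : F (c1 g, y) = d (act g (cinv c y)) by rewrite /F /= (cmapK cg).
have DE : 'd F (c1 g, x) (0, e) = Dloc c d (act g) p e.
  apply: etrans (esym (congr1 (fun h => h e) D)) _.
  rewrite (_ : (fun y => F (c1 g, y)) = fun y => d (act g (cinv c y)));
    last exact/funext.
  by rewrite /Dloc (cinvK cx).
have num : \sum_i ('d F (c1 g, x) (0, e)) 0 i * form_in M d omega (F (c1 g,
  x)) (delta_mx 0 i) =
    multiplier M omega (act g) p * a (c1 g, x).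
  apply: etrans (esym (form_in_sum _ _ _ omega_contact.1)) _.
  rewrite FE DE; apply: etrans (form_in_pullback omega e (act_smooth1 g) ac ad
    cp dp) _.
  have E3 := multiplierE (Dloc c (chart_at M p) id p e) omega_contact (@act_ker
    g p).
  apply: etrans E3 _.
  by rewrite /a -(form_inE M omega e cp) (cinvK cx).
by rewrite /Psi num FE (cmapK dp) mulfK.
Qed.

End SmoothAction.

Section Averaging.
Context {R : realType} {n k : nat} {T : topologicalType}
  (M : manifold R n.*2.+1 T) {G : topologicalSpaceGroupType} (S : manifold R k G)
  (act : G -> T -> T) (act_smooth : smooth_action S M act)
  (act_proper : proper_action act) (G_lie : lie_group S).
Context (omega : T -> 'rV[R]_(n.*2.+1) -> R)
  (J : T -> 'rV[R]_(n.*2.+1) -> 'rV[R]_(n.*2.+1)) (n_gt0 : (0 < n)%N)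
  (omega_ph : pseudo_hermitian M omega J)
  (act_CR : forall g, Aut_CR M (form_ker omega) J (act g)).

Let lam g p := multiplier M omega (act g) p.

Lemma action_smooth_map g : smooth_map M M (act g).
Proof. by have [[]] := act_CR g. Qed.

Lemma action_continuous g : continuous (act g).
Proof. by case: (action_smooth_map g). Qed.

Lemma action_multiplier_gt0 g p : 0 < lam g p.
Proof. exact: multiplier_gt0 n_gt0 omega_ph (act_CR g). Qed.

Lemma action_multiplierM g h p : lam (g * h)%g p = lam g (act h p) * lam h p.
Proof.
have [_ actM _] := act_smooth; have [co _ _ _ _] := omega_ph.
rewrite /lam (_ : act (g * h)%g = act g \o act h); last by apply/funext => q;
  exact: actM.
apply: multiplier_comp => //; try exact: action_smooth_map.
  exact: Aut_CR_preserves_ker (act_CR g).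
exact: Aut_CR_preserves_ker (act_CR h).
Qed.

Lemma compact_transporter (B C : set T) : compact B -> compact C ->
  compact [set g | exists2 p, B p & C (act g p)].
Proof.
move=> cB cC; have := act_proper (compact_setX cC cB).
move=> cE; have : compact (fst @` [set z : G * T | (C `*` B) (act z.1 z.2, z.2)]).
  apply: (continuous_compact _ cE).
  by apply: continuous_subspaceT => z; exact: cvg_fst.
congr compact; apply/seteqP; split=> [_ [[g p] [/= Cgp Bp] <-]|g [p Bp Cgp]].
  by exists p.
by exists (g, p).
Qed.

Definition saturation (A : set T) := [set p | exists g, A (act g p)].

Lemma saturation_act A g p : saturation A (act g p) <-> saturation A p.
Proof.
have [act1 actM _] := act_smooth.
split=> -[h Ah]; first by exists (h * g)%g; rewrite actM.
by exists (h * g^-1)%g; rewrite -actM -mulgA mulVg mulg1.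
Qed.

Lemma open_saturation A : open A -> open (saturation A).
Proof.
move=> oA; rewrite openE => p [g Agp].
have : nbhs p (act g @^-1` A).
  by apply: (action_continuous (g := g)); exact: open_nbhs_nbhs.
by apply: filterS => q; exists g.
Qed.

(** Within a compact [B] the saturation is the projection of a set that is compact by properness,
    hence it is closed there; compact neighbourhoods make this enough. *)
Lemma closed_saturation A : compact A -> closed (saturation A).
Proof.
move=> cA; rewrite -openC openE => p nAp.
have [B cB pB] := compact_nbhs_exists M p.
have cD : compact (B `&` saturation A).
  have := act_proper (compact_setX cA cB) => cE.
  have : compact (snd @` [set z : G * T | (A `*` B) (act z.1 z.2, z.2)]).
    apply: (continuous_compact _ cE).
    by apply: continuous_subspaceT => z; exact: cvg_snd.
  congr compact; apply/seteqP; split=> [_ [[g q] [/= Agq Bq] <-]|q [Bq [g Agq]]].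
    by split=> //; exists g.
  by exists (g, q).
have clD : closed (B `&` saturation A).
  by apply: compact_closed => //; exact: mfd_hausdorff M.
have : nbhs p (~` (B `&` saturation A)).
  by apply: open_nbhs_nbhs; split; [exact: closed_openC|move=> []].
by move=> nD; apply: filterS2 pB nD => q Bq nBA Aq; apply: nBA.
Qed.

Lemma group_bump (U : set G) : nbhs (1%g : G) U ->
  exists phi : G -> R, [/\ Ccp phi, 0 < phi 1%g & forall g, phi g != 0 -> U g].
Proof.
move=> /(manifold_bump S)[chi [sc c0 c1 [C [cC CU chiC]]]].
exists chi; split=> //; last by move=> g /chiC/CU.
by split=> //; split; [exact: smooth_fun_continuous sc|exists C].
Qed.

Context (L : (G -> R) -> R)
  (LD : forall f h, Cc f -> Cc h -> L (fun g => f g + h g) = L f + L h)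
  (LZ : forall a f, Cc f -> L (fun g => a * f g) = a * L f)
  (Lt : forall t f, Cc f -> L (fun g => f (g * t)%g) = L f)
  (L_ge0 : forall f, Ccp f -> 0 <= L f)
  (L_gt0 : forall f, nonneg_nonzero f -> 0 < L f).

(* The density of the average over G of the forms g^*(chi omega). *)
Definition average (chi : T -> R) (p : T) : R :=
  L (fun g => lam g p * chi (act g p)).

Section OneCutoff.
Context (chi : T -> R) (C : set T) (chi_smooth : smooth_fun M chi)
  (C_compact : compact C) (chi_supp : forall p, chi p != 0 -> C p)
  (chi_ge0 : forall p, 0 <= chi p).

Lemma average_param_smooth j c : atlas M c ->
  class_Ck_param j (cimg c) (fun g x =>
    lam g (cinv c x) * chi (act g (cinv c x))).
Proof.
move=> ac; have [_ _ sm] := act_smooth; have [co _ _ _ _] := omega_ph.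
apply: (class_Ck_multiplier_param sm action_smooth_map co) => //.
by move=> g; exact: Aut_CR_preserves_ker (act_CR g).
Qed.

Lemma Cc_average p : Cc (fun g => lam g p * chi (act g p)).
Proof.
have cp := chart_at_dom M p.
split=> [g|].
  have C0 := class_Ck_param_continuous (average_param_smooth 0 (chart_at_atlas
    M p)) (g := g) (cimg_map cp).
  rewrite (_ : (fun g => lam g p * chi (act g p)) = fun g =>
    lam g (cinv (chart_at M p) (chart_at M p p)) *
    chi (act g (cinv (chart_at M p) (chart_at M p p)))).
    exact: (@continuous_slice _ _ _ (fun g x => lam g (cinv (chart_at M p) x) *
      chi (act g (cinv (chart_at M p) x))) g (chart_at M p p) C0).
  by apply/funext => h; rewrite (cmapK cp).
exists [set g | exists2 q, [set p] q & C (act g q)].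
  by apply: compact_transporter => //; exact: compact_set1.
by move=> g; rewrite mulf_eq0 negb_or => /andP[_ /chi_supp ?]; exists p.
Qed.

Lemma Ccp_average p : Ccp (fun g => lam g p * chi (act g p)).
Proof.
split=> [|g]; first exact: Cc_average.
by rewrite mulr_ge0 // ltW // action_multiplier_gt0.
Qed.

Lemma average_ge0 p : 0 <= average chi p.
Proof. exact/L_ge0/Ccp_average. Qed.

Lemma average_gt0 p g : 0 < chi (act g p) -> 0 < average chi p.
Proof.
move=> cg; apply: L_gt0; split; first exact: Ccp_average.
by exists g; rewrite mulr_gt0 // action_multiplier_gt0.
Qed.

Lemma average_eq0 p : (forall g, ~ C (act g p)) -> average chi p = 0.
Proof.
move=> nC; have z g : lam g p * chi (act g p) = 0 * (lam g p * chi (act g p)).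
  have /eqP -> : chi (act g p) == 0 by apply: contra_notT (nC g) => /chi_supp.
  by rewrite !mulr0.
rewrite /average (_ : (fun g => _) = fun g => 0 * (lam g p * chi (act g p))).
  by rewrite LZ ?mul0r //; exact: Cc_average.
exact/funext.
Qed.

Lemma average_equivariant h p : average chi (act h p) * lam h p = average chi p.
Proof.
have [_ actM _] := act_smooth.
have E1 := LZ (lam h p) (Cc_average (act h p)).
have E2 := Lt h (Cc_average p).
rewrite mulrC; apply: etrans (esym E1) _; apply: etrans _ E2.
apply: (congr1 L); apply/funext => g.
by rewrite action_multiplierM actM mulrA (mulrC (lam h p)).
Qed.

(** While the point stays in a compact neighbourhood [B], only those [g] carrying some point of [B]
    into [C] contribute; they form a compact set, so differentiation under [L] applies. *)
Lemma average_smooth : smooth_fun M (average chi).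
Proof.
move=> c ac j; apply: class_Ck_local => x0 cx0.
have [B cB pB] := compact_nbhs_exists M (cinv c x0).
pose U := [set x | cimg c x /\ interior B (cinv c x)].
exists U; first by split=> //; exact: nbhs_interior pB.
have oU : open U by apply: open_cimg_preimage; exact: open_interior.
have mulc : continuous (fun z : G * G => (z.1 * z.2)%g) by case: G_lie => -[].
have cK := compact_transporter cB C_compact.
apply: (class_Ck_functional LD LZ L_ge0 (fun K =>
  @Ccp_pos_on_compact R G mulc group_bump K)
  (has_basis_rV _) oU cK); last first.
  by apply: class_Ck_param_sub (average_param_smooth j ac) => x [].
move=> g x [cx Bx] nK; have /eqP -> : chi (act g (cinv c x)) == 0;
  last by rewrite mulr0.
apply: contra_notT nK => /chi_supp Cg; exists (cinv c x) => //.
exact: interior_subset Bx.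
Qed.

End OneCutoff.

Lemma invariant_density : exists h : T -> R, [/\ smooth_fun M h,
  forall p, 0 < h p & forall g p, h (act g p) * lam g p = h p].
Proof.
have [act1 actM _] := act_smooth.
have [K [K0 cK KS KT]] := compact_exhaustion M.
have Kmono i j : (i <= j)%N -> K i `<=` K j.
  elim: j => [|j IH]; first by rewrite leqn0 => /eqP ->.
  rewrite leq_eqVlt => /orP[/eqP -> //|/IH H]; apply: subset_trans H _.
  by move=> x /KS /interior_subset.
(* [D j] keeps the points of [K j.+1] whose orbits miss the interior of [K j]; it is compact because
   that interior has an open saturation. [W j] goes one index lower so as to be an open set
   containing [D j]; at [j = 0] the truncated predecessor is harmless, as [K 0] is empty. *)
pose W j := ~` saturation (K j.-1).
pose D j := K j.+1 `&` ~` saturation (interior (K j)).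
have oW j : open (W j) by exact/closed_openC/closed_saturation.
have cD j : compact (D j).
  apply: compact_closedI => //; apply: open_closedC; apply: open_saturation.
  exact: open_interior.
have DW j : D j `<=` W j.
  move=> p [_ nS] [g Kg]; apply: nS; exists g.
  case: j Kg => [|j] /=; [by rewrite K0|exact: KS].
(* The cutoff chi j is supported off the saturation of K j.-1, so that its
   average F j vanishes on K i for i < j. *)
have bump j := smooth_bump_compact M (cD j) (oW j) (DW j).
pose chi j := projT1 (cid (bump j)).
have chiP j : [/\ smooth_fun M (chi j), forall p, 0 <= chi j p,
    forall p, D j p -> 0 < chi j p &
    exists C, [/\ compact C, C `<=` W j & forall p, chi j p != 0 -> C p]].
  by rewrite /chi; case: cid.
pose F j := average (chi j).
have Fs j : smooth_fun M (F j).
  have [sc c0 _ [C [cC _ sup]]] := chiP j; exact: average_smooth sc cC sup.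
have F0 j p : 0 <= F j p.
  have [sc c0 _ [C [cC _ sup]]] := chiP j; exact: average_ge0 sc cC sup c0 p.
have Fe j g p : F j (act g p) * lam g p = F j p.
  have [sc c0 _ [C [cC _ sup]]] := chiP j;
    exact: average_equivariant sc cC sup g p.
have Fz i j p : K i p -> (i < j)%N -> F j p = 0.
  move=> Kp ij; have [sc c0 _ [C [cC CW sup]]] := chiP j.
  apply: (average_eq0 sc cC sup) => g /CW; apply.
  exists g^-1%g; rewrite -actM mulVg act1; apply: Kmono Kp.
  by case: j ij {sc c0 cC CW sup} => [|j]; rewrite // ltnS.
pose N p := projT1 (cid (KT p)).
have NP p : K (N p) p by rewrite /N; case: cid.
(* The sum of all [F j], truncated at an index depending on [p]: on [K i] the later terms vanish, so
   any longer truncation gives the same value, and near each point one truncation serves. *)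
pose h p := \sum_(j < (N p).+1) F j p.
have trunc i l p : K i p -> (i <= l)%N ->
    \sum_(j < l.+1) F j p = \sum_(j < i.+1) F j p.
  move=> Kp il; rewrite -!(big_mkord xpredT (fun j => F j p)).
  rewrite (@big_cat_nat _ _ _ i.+1) //= [X in _ + X]big_nat_cond.
  by rewrite [X in _ + X]big1 ?addr0 // => j /andP[/andP[ij _] _];
    exact: Fz Kp ij.
have hE i p : K i p -> h p = \sum_(j < i.+1) F j p.
  move=> Kp; rewrite /h -(trunc _ (maxn i (N p)) _ (NP p) (leq_maxr _ _)).
  exact: trunc (leq_maxl _ _).
exists h; split.
- move=> c ac l; apply: class_Ck_local => x0 cx0; set p0 := cinv c x0.
  pose i := (N p0).+1.
  exists [set x | cimg c x /\ interior (K i) (cinv c x)].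
    by split=> //; apply: KS; exact: NP.
  have oA : open [set x | cimg c x /\ interior (K i) (cinv c x)].
    by apply: open_cimg_preimage; exact: open_interior.
  apply: (@eq_class_Ck _ _ _ _ _ (fun x => \sum_(j < i.+1) F j (cinv c x))) => //.
    by move=> x [_ /interior_subset Kx]; rewrite (hE i).
  apply: class_Ck_sum => // j.
  by apply: class_Ck_sub (Fs j c ac l) => x [].
(* The least index for which the orbit of [p] meets [K] is not 0, so it is some [i.+1]. By
   minimality the orbit misses [K i], hence its point in [K i.+1] lies in [D i], where the cutoff is
   positive. *)
- move=> p; have ex : exists i, `[< saturation (K i) p >].
    have [i Kp] := KT p; exists i; apply/asboolP; exists 1%g.
    by rewrite act1.
  case: (ex_minnP ex) => -[|i] /asboolP[g Kg] min; first by move: Kg; rewrite K0.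
  have Fi : 0 < F i p.
    have [sc c0 cD' [C [cC _ sup]]] := chiP i.
    apply: (average_gt0 sc cC sup c0 (g := g)); apply: cD'; split=> //.
    move=> /saturation_act [g' Kg'].
    suff : (i < i)%N by rewrite ltnn.
    by apply: min; apply/asboolP; exists g'; exact: interior_subset Kg'.
  rewrite (hE _ p (Kmono _ _ (leq_maxl (N p) i) _ (NP p))).
  have il : (i < (maxn (N p) i).+1)%N by rewrite ltnS leq_maxr.
  rewrite (bigD1 (Ordinal il)) //= ltr_pwDl // sumr_ge0 //.
- move=> g p; pose i := maxn (N (act g p)) (N p).
  rewrite (hE i); last exact: Kmono (leq_maxl _ _) _ (NP _).
  rewrite (hE i p); last exact: Kmono (leq_maxr _ _) _ (NP _).
  by rewrite mulr_suml; apply: eq_bigr => j _; exact: Fe.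
Qed.

End Averaging.

Theorem theorem23 (R : realType) (n : nat) (n_gt0 : (0 < n)%N)
    (T : topologicalType) (T_connected : connected [set: T])
    (M : manifold R n.*2.+1 T)
    (D : T -> set 'rV[R]_(n.*2.+1))
    (J : T -> 'rV[R]_(n.*2.+1) -> 'rV[R]_(n.*2.+1))
    (DJ_CR : strictly_pseudoconvex_CR M D J)
    (k : nat) (G : topologicalSpaceGroupType) (S : manifold R k G)
    (G_lie : lie_group S)
    (act : G -> T -> T)
    (act_smooth : smooth_action S M act)
    (act_inj : injective act)
    (act_CR : forall g : G, Aut_CR M D J (act g))
    (act_proper : proper_action act) :
  exists eta : T -> 'rV[R]_(n.*2.+1) -> R,
    [/\ pseudo_hermitian M eta J,
        form_ker eta = D
      & forall g : G, Psh M eta J (act g)].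
Proof.
have [omega [omega_ph kerD]] := DJ_CR; subst D.
have [co _ _ _ _] := omega_ph.
have mulc : continuous (fun z : G * G => (z.1 * z.2)%g) by case: G_lie => -[].
have invc : continuous (fun g : G => g^-1%g) by case: G_lie => _ [].
have [L [LD LZ Lt L_ge0 L_gt0]] :=
  haar_functional mulc (mfd_hausdorff S) invc (group_bump S).
have [h [sh h0 he]] := invariant_density act_smooth act_proper G_lie n_gt0
  omega_ph act_CR LD LZ Lt L_ge0 L_gt0.
exists (fun p v => h p * omega p v); split.
- exact: (pseudo_hermitian_rescale co.1 sh h0 omega_ph).
- exact: (form_ker_rescale omega h0).
- move=> g; exact: (Psh_rescale h0 co (act_CR g) (he g)).
Qed.
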